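(* Let $X$ be a smooth complex variety, $Z\ne 0$ a reduced effective divisor on $X$, $\alpha\in(0,1]$ a rational number, and $p\ge 0$ an integer. Then $$I_p(\alpha Z)=\mathcal{O}_X\iff p\le\widetilde{\alpha}_Z-\alpha.$$
   Context: Hodge ideals. Let $D=\alpha Z$, $\beta=1-\alpha$. The ideals $I_p(D)$, $p\ge0$, are defined locally, so let $f$ be an equation of $Z$ on $X$ (the result does not depend on $f$). Let $\mathcal{O}_X( *Z)=\bigcup_{m\ge0}\mathcal{O}_X(mZ)$ and let $\mathcal{M}(f^\beta)=\mathcal{O}_X( *Z)f^\beta$ be the free rank one $\mathcal{O}_X( *Z)$-module on the symbol $f^\beta$, with $\mathcal{D}_X$-action given by $\xi(wf^\beta)=\big(\xi(w)+w\frac{\beta\,\xi(f)}{f}\big)f^\beta$ for derivations $\xi$. Let $U=X\smallsetminus Z$, $j\colon U\hookrightarrow X$ the inclusion, $\ell\ge2$ an integer with $\ell\beta\in\mathbf{Z}$, and $\pi\colon W=\mathrm{Spec}\,\mathcal{O}_U[y]/(y^\ell-f^{\ell\beta})\to U$, a finite étale cover. Then $\pi_+\mathcal{O}_W=\bigoplus_{i=0}^{\ell-1}\mathcal{O}_Uy^i$ as $\mathcal{D}_U$-modules and $\mathcal{O}_Uy\simeq\mathcal{M}(f^\beta)|_U$ via $y\leftrightarrow f^\beta$, so $\mathcal{M}(f^\beta)$ is a direct summand of $j_+\pi_+\mathcal{O}_W$. The latter underlies the mixed Hodge module $j_*\pi_*\mathbf{Q}^H_W[\dim X]$ and so has a Hodge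 filtration (normalized by $F_k\mathcal{O}_W=\mathcal{O}_W$ for $k\ge0$ and $F_k\mathcal{O}_W=0$ for $k<0$); $F_k\mathcal{M}(f^\beta)$ denotes the induced filtration on this filtered direct summand (independent of $\ell$). It is known that $F_p\mathcal{M}(f^\beta)=I_p(D)\cdot\mathcal{O}_X\big((p+1)Z\big)f^\beta$ for a coherent ideal sheaf $I_p(D)\subseteq\mathcal{O}_X$, the $p$-th Hodge ideal of $D$; equivalently, $g\in I_p(D)$ iff $\frac{g}{f^{p+1}}f^\beta\in F_p\mathcal{M}(f^\beta)$. Minimal exponent. For a nonzero $f\in\mathcal{O}_X(X)$, the Bernstein-Sato polynomial $b_f(s)\in\mathbf{C}[s]$ is the nonzero monic polynomial of minimal degree with $b_f(s)f^s\in\mathcal{D}_X[s]\cdot f^{s+1}$. For a nonzero effective divisor $E$ with equations $f_i$ on the members of a finite open cover $X=\bigcup_iU_i$, $b_E(s)$ is the least common multiple of the $b_{f_i}(s)$. It is divisible by $s+1$, and $\widetilde{b}_E(s)=b_E(s)/(s+1)$; all roots of $b_E$ are negative rational numbers. The minimal exponent $\widetilde{\alpha}_E$ is the negative of the largest root of $\widetilde{b}_E(s)$, with $\widetilde{\alpha}_E=\infty$ if $\widetilde{b}_E$ is constant. *)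

(* Defs.v *)
From HB Require Import structures.
From mathcomp Require Import all_boot all_order all_algebra.
From mathcomp Require Import complex.
From mathcomp Require Import boolp classical_sets reals constructive_ereal.

Set Implicit Arguments.
Unset Strict Implicit.
Unset Printing Implicit Defensive.

Import Order.TTheory GRing.Theory Num.Theory.

Local Open Scope classical_set_scope.
Local Open Scope ring_scope.

(** * Commutative algebra inside a field [K], an extension of [k] by [iota] *)

Section CommutativeAlgebra.
Context {k K : fieldType} (iota : {rmorphism k -> K}).
Implicit Types A O L M I J P m : set K.

Definition subalgebra A :=
  [/\ forall c, A (iota c),
      forall a b, A a -> A b -> A (a - b)
    & forall a b, A a -> A b -> A (a * b)].

Definition finitely_generated A :=
  exists s : seq K, A = smallest subalgebra [set` s].

Definition has_fraction_field A :=
  forall a : K, exists b c, [/\ A b, A c, c != 0 & a = b / c].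

Definition is_ideal A I :=
  [/\ I `<=` A, I 0, forall a b, I a -> I b -> I (a + b)
    & forall a b, A a -> I b -> I (a * b)].

Definition prime_ideal A P :=
  [/\ is_ideal A P, ~ P 1
    & forall a b, A a -> A b -> P (a * b) -> P a \/ P b].

Definition maximal_ideal A m :=
  [/\ is_ideal A m, ~ m 1
    & forall I, is_ideal A I -> m `<=` I -> ~ I 1 -> I = m].

Definition localization A m : set K :=
  [set a | exists b c, [/\ A b, A c, ~ m c & a = b / c]].

(* The set of non-units of [O]: its maximal ideal when [O] is local. *)
Definition nonunits O : set K := [set a | O a /\ ~ (a != 0 /\ O a^-1)].

Definition prime_chain O (d : nat) (P : nat -> set K) :=
  (forall i, (i <= d)%N -> prime_ideal O (P i)) /\
  (forall i, (i < d)%N -> P i `<` P i.+1).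

Definition krull_dim O (d : nat) :=
  (exists P : nat -> set K, prime_chain O d P) /\
  (forall e (P : nat -> set K), prime_chain O e P -> (e <= d)%N).

(* For a Noetherian local ring [O]. *)
Definition regular_local O :=
  exists d, krull_dim O d /\
    exists e : 'I_d -> K, (forall i, nonunits O (e i)) /\
      forall a, nonunits O a ->
        exists c : 'I_d -> K, (forall i, O (c i)) /\ a = \sum_i c i * e i.

(** ** Varieties
  An integral separated scheme of finite type over [k] with function field [K]
  is determined by the set of its local rings, as subrings of [K] (Chevalley's
  schemata, EGA I, section 8).  For [k] algebraically closed we record, as in
  the classical language, only the local rings of the closed points: a variety
  is a set [X] of local subrings of [K], a point [x] of [X] *is* its local ring
  O_{X,x}, and the sections of O_X over an open [U] are the elements of [K]
  lying in every [x] of [U].  Sheaves of submodules of the constant sheaf [K]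
  (or of a direct sum of copies of [K]) are described by their stalks at the
  closed points. *)

Definition closed_points A : set (set K) :=
  [set x | exists m, maximal_ideal A m /\ x = localization A m].

(* "Anneaux locaux apparentes", EGA I, section 8. *)
Definition allied L M :=
  let LM := smallest subalgebra (L `|` M) in
  exists P, [/\ prime_ideal LM P, P `&` L = nonunits L & P `&` M = nonunits M].

(* Two points of [X] that are allied are equal: this says at once that the
   affine charts [A i] are glued along open subsets and that the result is
   separated, see loc. cit. *)
Definition is_variety (X : set (set K)) :=
  [/\ exists (n : nat) (A : 'I_n -> set K),
        [/\ forall i, subalgebra (A i), forall i, finitely_generated (A i),
            forall i, has_fraction_field (A i)
          & X = \bigcup_i closed_points (A i)],
      X !=set0
    & forall x y, X x -> X y -> allied x y -> x = y].

(* Over a perfect field, smooth is the same as regular. *)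
Definition is_smooth_variety (X : set (set K)) :=
  is_variety X /\ forall x, X x -> regular_local x.

(* The Zariski topology of [X] has as basis the domains of definition of the
   finite sets of rational functions. *)
Definition zariski_open (X U : set (set K)) :=
  U `<=` X /\
  forall x, U x -> exists s : seq K,
    [set` s] `<=` x /\ forall y, X y -> [set` s] `<=` y -> U y.

(** ** Effective Cartier divisors *)

Record divisor := Divisor {
  div_size : nat;
  div_open : 'I_div_size -> set (set K);
  div_eqn : 'I_div_size -> K }.

Definition effective_divisor (X : set (set K)) (Z : divisor) :=
  [/\ forall i, zariski_open X (@div_open Z i),
      forall x, X x -> exists i, @div_open Z i x,
      forall i, @div_eqn Z i != 0,
      forall i x, @div_open Z i x -> x (@div_eqn Z i)
    & forall i j x, @div_open Z i x -> @div_open Z j x ->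
        x (@div_eqn Z i / @div_eqn Z j)].

Definition nonzero_divisor (Z : divisor) :=
  exists i x, @div_open Z i x /\ ~ x (@div_eqn Z i)^-1.

(* The rings O_{Z,x} = O_{X,x} / (f) are reduced. *)
Definition reduced_divisor (Z : divisor) :=
  forall i x, @div_open Z i x ->
    forall (h : K) (n : nat), x h ->
      x (h ^+ n / @div_eqn Z i) -> x (h / @div_eqn Z i).

(** ** Derivations and Bernstein-Sato polynomials *)

(* A [k]-derivation of O_{X,x}, identified with its unique extension to the
   fraction field [K].  As X is smooth, D_{X,x} is generated by O_{X,x} and
   these derivations; hence below a D_{X,x}-submodule is an additive subgroup
   stable under O_{X,x} and under the derivations. *)
Definition derivation_at (x : set K) (xi : K -> K) :=
  [/\ forall a b, xi (a + b) = xi a + xi b,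
      forall a b, xi (a * b) = xi a * b + a * xi b,
      forall c, xi (iota c) = 0
    & forall a, x a -> x (xi a)].

(* The element w(s) f^s is encoded by the polynomial w, so that s acts as
   multiplication by 'X and a derivation acts by
   xi (w f^s) = (xi w + s w xi(f) / f) f^s. *)
Definition Ds_submodule (x : set K) (f : K) (N : set {poly K}) :=
  [/\ N 0 /\ (forall u v, N u -> N v -> N (u + v)),
      forall a u, x a -> N u -> N (a *: u),
      forall u, N u -> N ('X * u)
    & forall xi u, derivation_at x xi -> N u ->
        N (map_poly xi u + (xi f / f) *: ('X * u))].

(* b(s) f^s \in D_X[s] . f^{s+1} over the open set [U]. *)
Definition bs_equation (U : set (set K)) (f : K) (b : {poly k}) :=
  forall x, U x -> smallest (Ds_submodule x f) [set f%:P] (map_poly iota b).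

Definition is_bernstein_sato (U : set (set K)) (f : K) (b : {poly k}) :=
  [/\ b \is monic, bs_equation U f b
    & forall q, q != 0 -> bs_equation U f q -> (size b <= size q)%N].

(* The least common multiple of the b_{f_i}. *)
Definition is_bernstein_sato_divisor (Z : divisor) (b : {poly k}) :=
  b \is monic /\
  exists bs : 'I_(div_size Z) -> {poly k},
    (forall i, is_bernstein_sato (@div_open Z i) (@div_eqn Z i) (bs i)) /\
    (forall q : {poly k}, (b %| q) <-> (forall i, bs i %| q)).

End CommutativeAlgebra.

Arguments divisor K : clear implicits.

Section HodgeIdeals.
Context {R : realType} {K : fieldType} (iota : {rmorphism R[i] -> K}).

(** ** The minimal exponent *)

(* On R[i] the relation z <= w means that w - z is a nonnegative real number;
   all the roots of b_Z are negative rational numbers. *)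
Definition largest_root (b : {poly R[i]}) (r : R) :=
  root b (r%:C)%C /\ forall z, root b z -> z <= (r%:C)%C.

Definition is_minimal_exponent (Z : divisor K) (a : \bar R) :=
  exists b, is_bernstein_sato_divisor iota Z b /\
    let b' := b %/ ('X + 1) in
    match a with
    | r%:E => largest_root b' (- r)
    | +oo%E => (size b' <= 1)%N
    | -oo%E => False
    end.

(** ** The Hodge filtration
  Locally at a point x, let f be an equation of Z, U the complement of Z and
  W = Spec O_U[y] / (y^l - f^(l beta)).  Since pi : W -> U is etale,
  derivations extend uniquely to O_W and xi y = beta (xi f / f) y.  Hence
    j_+ pi_+ O_W = \bigoplus_(i < l) O_X( *Z) y^i,
    xi (w y^i) = (xi w + i beta w xi f / f) y^i,
  and its direct image under the graph embedding X -> X * A^1 of f is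
    N = \bigoplus_(i < l) \bigoplus_j O_X( *Z) y^i d_t^j delta.
  An element of N is encoded by the function sending i to the polynomial, in
  the variable 'X = d_t, of its coefficients on the y^i d_t^j delta. *)

Section AtPoint.
Variables (x : set K) (f : K) (l : nat) (beta : rat).

Local Notation E := {ffun 'I_l -> {poly K}}.
Implicit Types (u v : E) (N : set E) (V : R -> set E).

(* The stalk of O_X( *Z). *)
Definition poles : set K := [set a | exists n, x (a * f ^+ n)].

Definition graph_module : set E := [set u : E | forall i j, poles (u i)`_j].

Definition act_scalar (a : K) u : E := [ffun i => a *: u i].

Definition act_t u : E := [ffun i => f *: u i - (u i)^`()].

Definition act_dt u : E := [ffun i => 'X * u i].

Definition act_der (xi : K -> K) u : E :=
  [ffun i : 'I_l => map_poly xi (u i)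
     + (i%:R * ratr beta * (xi f / f)) *: u i - xi f *: ('X * u i)].

(* V^0 D_{X * A^1} is generated by D_X, t and d_t t. *)
Definition V0D_submodule N :=
  [/\ N 0 /\ (forall u v, N u -> N v -> N (u + v)),
      forall a u, x a -> N u -> N (act_scalar a u),
      forall xi u, derivation_at iota x xi -> N u -> N (act_der xi u),
      forall u, N u -> N (act_t u)
    & forall u, N u -> N (act_dt (act_t u))].

Definition act_euler (g : R) u : E :=
  act_dt (act_t u) - act_scalar (iota (g%:C)%C) u.

(* The V-filtration of Kashiwara and Malgrange along t = 0, decreasing,
   indexed for left D-modules so that d_t t - g is nilpotent on Gr_V^g.  It is
   unique.  Its jumps are rational, so that indexing by R or by Q is the same. *)
Definition is_V_filtration V :=
  [/\ forall g, V g `<=` graph_module /\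
        exists s : seq E, V g = smallest V0D_submodule [set` s],
      (forall g h : R, g <= h -> V h `<=` V g) /\
        (forall u, graph_module u -> exists g, V g u),
      forall g, exists2 e : R, 0 < e &
        (forall h : R, g - e < h <= g -> V h = V g) /\
        (forall h h' : R, g < h < g + e -> g < h' < g + e -> V h = V h'),
      [/\ forall g u, V g u -> V (g + 1) (act_t u),
          exists g0 : R, forall g : R, g0 <= g -> V (g + 1) = act_t @` V g
        & forall g u, V g u -> V (g - 1) (act_dt u)]
    & forall g, exists n, forall u, V g u ->
        exists2 h : R, g < h & V h (iter n (act_euler g) u)].

Definition V_filtration (g : R) : set E :=
  [set u : E | exists2 V, is_V_filtration V & V g u].

(* As F_k O_W = O_W for k >= 0 and F_k O_W = 0 for k < 0, on the complement of
   t = 0 the Hodge filtration F_k N is the part of degree <= k in d_t. *)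
Definition F_open (k : nat) : set E :=
  [set u : E | graph_module u /\ forall i, (size (u i) <= k.+1)%N].

(* Saito's construction of the Hodge filtration of an open direct image across
   a hypersurface t = 0:
   F_p N = \sum_(i >= 0) d_t^i (V^0 N \cap j_* F_(p - i) (N|_(t != 0))). *)
Definition F_graph (p : nat) : set E :=
  [set u : E | exists v : 'I_p.+1 -> E,
     (forall i : 'I_p.+1, (V_filtration 0 `&` F_open (p - i)) (v i)) /\
     u = \sum_(i < p.+1) iter i act_dt (v i)].

(* The element w y delta of N. *)
Definition y_delta (w : K) : E :=
  [ffun i : 'I_l => if i == 1%N :> nat then w%:P else 0].

(* The filtration of the summand M(f^beta) = O_X( *Z) y, the element w f^beta
   being encoded by w.  The Hodge filtration of the graph direct image is
   F_p N = \bigoplus_j (F_(p - j) (j_+ pi_+ O_W)) d_t^j delta. *)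
Definition F_M (p : nat) : set K := [set w | F_graph p (y_delta w)].

End AtPoint.

(* The stalk at x of I_p(alpha Z); it does not depend on the equation of Z, nor
   on l >= 2 with l (1 - alpha) an integer. *)
Definition hodge_ideal (Z : divisor K) (alpha : rat) (l p : nat) (x : set K)
    : set K :=
  [set g | x g /\ forall i, @div_open K Z i x ->
     let f := @div_eqn K Z i in F_M x f l (1 - alpha) p (g / f ^+ p.+1)].

End HodgeIdeals.

(* Main.v *)
Require Import Defs.
From HB Require Import structures.
From mathcomp Require Import all_boot all_order all_algebra.
From mathcomp Require Import complex ring lra zify.
From mathcomp Require Import boolp classical_sets reals constructive_ereal.

(** Everything happens at a point [x] with an equation [f], in the module
  O_X( *Z)[s] f^s, where t acts by s |-> s + 1 and d_t = - s t^-1; on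
  the summand of y^i, identified with it by y^i delta = f^s, only d_t changes, to
  - (s - i beta) t^-1.  Write L = D[s] f^s and
  b(s) = (s + 1) b'(s).  Since b(s) L is contained in t L, every t^m L / t^n L
  is killed by a polynomial in s, and cutting these quotients along generalized
  eigenspaces of s produces the V-filtration.  Moreover b' is the minimal
  polynomial of s on D[s] f^s / D[s] (f, J_f) f^s, with J_f spanned by the
  derivatives of f.

  If all roots of b' are at most - (alpha + p), then b'(s - j) d_t^j f^s lies in
  D[s] d_t^(j-1) f^s, hence d_t^j f^s is in V^alpha for j <= p, and f^-(p+1) is
  recovered from these elements by commuting d_t with powers of t.

  Conversely, if 1 is in I_p then f^-(p+1) = sum_i d_t^i v_i in the summand of y,
  where d_t is divisible by s - beta: at s = beta only v_0 contributes.  So t v_0,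
  an element of V^alpha, has the form sum_(j <= p) q_j d_t^j f^s with q_j in O_X and 1 in (q_p, f).  Being
  in V^alpha it is sent to t L by some P(s) with roots at most - alpha, so that
  P(s) d_t^p f^s is in D[s] (f f^s, d_t^j f^s | j < p); comparing degrees in s,
  P(s + p) f^s is in D[s] (f, J_f) f^s, whence b_x divides (s + 1) P(s + p). *)

Set Implicit Arguments.
Unset Strict Implicit.
Unset Printing Implicit Defensive.

Import Order.TTheory GRing.Theory Num.Theory.

Local Open Scope classical_set_scope.
Local Open Scope ring_scope.

(** * The action of t and d_t *)

Section Twisted.
Context {K : fieldType} (f : K).
Implicit Types (u v w p : {poly K}) (c : K) (k : int).

(* The polynomial w stands for w(s) f^s; then t^k is s |-> s + k, also for k < 0. *)
Definition tpow k w : {poly K} := f ^ k *: (w \Po ('X + (k%:~R)%:P)).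

Fact tpow_is_linear k : linear (tpow k).
Proof.
by move=> a u v; rewrite /tpow comp_polyD comp_polyZ scalerDr !scalerA mulrC.
Qed.
HB.instance Definition _ k :=
  GRing.isLinear.Build K {poly K} {poly K} *:%R (tpow k) (tpow_is_linear k).

Lemma tpow_add k u v : tpow k (u + v) = tpow k u + tpow k v.
Proof. exact: linearD. Qed.

Lemma tpow_scale k a u : tpow k (a *: u) = a *: tpow k u.
Proof. exact: linearZ. Qed.

Lemma tpow0 w : tpow 0 w = w.
Proof. by rewrite /tpow expr0z scale1r addr0 comp_polyXr. Qed.

Lemma tpowM k p w : tpow k (p * w) = (p \Po ('X + (k%:~R)%:P)) * tpow k w.
Proof. by rewrite /tpow comp_polyM -scalerAr. Qed.

Lemma tpowX k w : tpow k ('X * w) = ('X + (k%:~R)%:P) * tpow k w.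
Proof. by rewrite tpowM comp_polyX. Qed.

Lemma tpowC k a : tpow k a%:P = (f ^ k * a)%:P.
Proof. by rewrite /tpow comp_polyC -mul_polyC -polyCM. Qed.

Hypothesis f_neq0 : f != 0.

Lemma tpowD k l w : tpow k (tpow l w) = tpow (k + l) w.
Proof.
rewrite /tpow comp_polyZ scalerA -expfzDr // -comp_polyA; congr (_ *: (_ \Po _)).
by rewrite comp_polyD comp_polyX comp_polyC intrD polyCD addrA.
Qed.

Lemma tpowK k : cancel (tpow k) (tpow (- k)).
Proof. by move=> w; rewrite tpowD addNr tpow0. Qed.

Lemma tpowNK k : cancel (tpow (- k)) (tpow k).
Proof. by move=> w; rewrite tpowD addrN tpow0. Qed.

Lemma size_tpow k w : size (tpow k w) = size w.
Proof.
rewrite /tpow size_scale ?expfz_neq0 // size_comp_poly2 //.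
by rewrite size_XaddC.
Qed.

(* The action of d_t on w(s) f^s when - d_t t is s - c. *)
Definition dt c w : {poly K} := - (('X - c%:P) * tpow (-1) w).

Fact dt_is_linear c : linear (dt c).
Proof.
by move=> a u v; rewrite /dt linearP mulrDr opprD -scalerAr scalerN.
Qed.
HB.instance Definition _ c :=
  GRing.isLinear.Build K {poly K} {poly K} *:%R (dt c) (dt_is_linear c).

Lemma dt_add c u v : dt c (u + v) = dt c u + dt c v.
Proof. exact: linearD. Qed.

Lemma dt_scale c a u : dt c (a *: u) = a *: dt c u.
Proof. exact: linearZ. Qed.

Lemma dtC c a : dt c a%:P = - ((f^-1 * a) *: ('X - c%:P)).
Proof. by rewrite /dt tpowC exprN1 mulrC mul_polyC. Qed.

Lemma dtX c w : dt c ('X * w) = ('X - 1) * dt c w.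
Proof. rewrite /dt tpowX polyCN; ring. Qed.

Lemma tpow_dt c w : tpow 1 (dt c w) = - (('X + 1 - c%:P) * w).
Proof.
rewrite /dt -mulNr tpowM (tpowNK 1) rmorphN rmorphB /= comp_polyX comp_polyC.
ring.
Qed.

Lemma dt_tpow c w : dt c (tpow 1 w) = - (('X - c%:P) * w).
Proof. by rewrite /dt tpowK. Qed.

Lemma size_dt c w : w != 0 -> size (dt c w) = (size w).+1.
Proof.
move=> w0; rewrite /dt size_polyN size_monicM ?monicXsubC //.
  by rewrite size_tpow size_XsubC.
by rewrite -size_poly_eq0 size_tpow size_poly_eq0.
Qed.

Lemma iter_dt_is_linear c j : linear (iter j (dt c)).
Proof. by elim: j => [//|j IH] a u v /=; rewrite IH linearP. Qed.

HB.instance Definition _ c j :=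
  GRing.isLinear.Build K {poly K} {poly K} *:%R (iter j (dt c))
    (iter_dt_is_linear c j).

Lemma iter_dt_add c j u v :
  iter j (dt c) (u + v) = iter j (dt c) u + iter j (dt c) v.
Proof. exact: linearD. Qed.

Lemma iter_dt_scale c j a u : iter j (dt c) (a *: u) = a *: iter j (dt c) u.
Proof. exact: linearZ. Qed.

Lemma size_iter_dt c j w : w != 0 -> size (iter j (dt c) w) = (size w + j)%N.
Proof.
move=> w0; elim: j => [|j IH] /=; first by rewrite addn0.
rewrite size_dt ?IH ?addnS // -size_poly_eq0 IH addn_eq0 size_poly_eq0.
by rewrite (negPf w0).
Qed.

(* The isomorphism from the d_t-encoding of Defs to the s-encoding. *)
Definition Phi c u : {poly K} := \sum_(j < size u) u`_j *: iter j (dt c) 1.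

Lemma Phi_widen c u n : (size u <= n)%N ->
  Phi c u = \sum_(j < n) u`_j *: iter j (dt c) 1.
Proof.
move=> le; rewrite /Phi (big_ord_widen n (fun j => u`_j *: iter j (dt c) 1)) //.
rewrite big_mkcond; apply: eq_bigr => j _; case: ltnP => // h.
by rewrite nth_default // scale0r.
Qed.

Fact Phi_is_linear c : linear (Phi c).
Proof.
move=> a u v; set n := maxn (size u) (size v).
have hu : (size u <= n)%N by rewrite leq_maxl.
have hv : (size v <= n)%N by rewrite leq_maxr.
rewrite (Phi_widen c hu) (Phi_widen c hv) (@Phi_widen c (a *: u + v) n).
  rewrite scaler_sumr -big_split /=; apply: eq_bigr => j _.
  by rewrite coefD coefZ scalerDl scalerA.
apply: leq_trans (size_polyD _ _) _; rewrite geq_max hv andbT.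
exact: leq_trans (size_scale_leq _ _) hu.
Qed.
HB.instance Definition _ c :=
  GRing.isLinear.Build K {poly K} {poly K} *:%R (Phi c) (Phi_is_linear c).

Lemma Phi_add c u v : Phi c (u + v) = Phi c u + Phi c v.
Proof. exact: linearD. Qed.

Lemma Phi_scale c a u : Phi c (a *: u) = a *: Phi c u.
Proof. exact: linearZ. Qed.

Lemma PhiC c a : Phi c a%:P = a%:P.
Proof.
by rewrite (@Phi_widen c _ 1) ?size_polyC_leq1 // big_ord1 coefC /= alg_polyC.
Qed.

Lemma Phi1 c : Phi c 1 = 1. Proof. exact: (PhiC c 1). Qed.

Lemma Phi_dt c u : Phi c ('X * u) = dt c (Phi c u).
Proof.
rewrite (@Phi_widen c _ (size u).+1); last first.
  by rewrite -[_ * u]addr0 -['X * u]mulrC size_MXaddC; case: ifP.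
rewrite big_ord_recl coefXM /= scale0r add0r /Phi linear_sum /=.
by apply: eq_bigr => j _; rewrite coefXM linearZ.
Qed.

Lemma Phi_iter_dt c j u : Phi c ('X^j * u) = iter j (dt c) (Phi c u).
Proof.
by elim: j => [|j IH]; rewrite ?mul1r // exprS -mulrA Phi_dt IH.
Qed.

Lemma Phi_cons c u a : Phi c (u * 'X + a%:P) = dt c (Phi c u) + a%:P.
Proof. by rewrite linearD /= PhiC mulrC Phi_dt. Qed.

(** [tpow_dt] and [dt_tpow] give [d_t, t] = 1 in the s-encoding, so t moves past each d_t as it does
    in the d_t-encoding, where it is f minus the derivative in d_t. *)
Lemma Phi_t c u : Phi c (f *: u - u^`()) = tpow 1 (Phi c u).
Proof.
elim/poly_ind: u => [|u a IH].
  by rewrite scaler0 deriv0 subr0 !linear0.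
rewrite Phi_cons [in RHS]linearD [in RHS]/= tpow_dt tpowC derivD derivC derivM derivX.
rewrite expr1z addr0 mulr1.
have -> : f *: (u * 'X + a%:P) - (u^`() * 'X + u)
  = 'X * (f *: u - u^`()) - u + (f * a)%:P.
  by rewrite -!mul_polyC polyCM; ring.
rewrite linearD linearB /= PhiC Phi_dt IH dt_tpow; ring.
Qed.

(** Each d_t raises the degree in s by exactly one. Hence the order filtration in d_t becomes the
    filtration by degree in s. *)
Lemma size_Phi c u : size (Phi c u) = size u.
Proof.
elim/poly_ind: u => [|u a IH]; first by rewrite linear0.
rewrite Phi_cons size_MXaddC.
have [->|u0] := eqVneq u 0.
  by rewrite !linear0 add0r size_polyC size_poly0; case: eqP.
have p0 : Phi c u != 0 by rewrite -size_poly_eq0 IH size_poly_eq0.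
rewrite /= size_polyDl size_dt ?IH //.
by rewrite (leq_ltn_trans (size_polyC_leq1 _)) // ltnS lt0n size_poly_eq0.
Qed.

Lemma Phi_inj c : injective (Phi c).
Proof.
move=> u v /eqP; rewrite -subr_eq0 -linearB -size_poly_eq0 size_Phi.
by rewrite size_poly_eq0 subr_eq0 => /eqP.
Qed.

End Twisted.

(** * The action of derivations *)

Section Derivations.
Context {k K : fieldType} (iota : {rmorphism k -> K}) (x : set K).
Context (xi : K -> K) (hxi : derivation_at iota x xi).
Implicit Types (a b : K) (u v w p q : {poly K}).

Let xiD a b : xi (a + b) = xi a + xi b. Proof. by case: hxi. Qed.

Lemma derM a b : xi (a * b) = xi a * b + a * xi b.
Proof. by case: hxi. Qed.

Lemma der_const c : xi (iota c) = 0. Proof. by case: hxi. Qed.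

Lemma der0 : xi 0 = 0. Proof. by have := der_const 0; rewrite rmorph0. Qed.

Lemma der1 : xi 1 = 0. Proof. by have := der_const 1; rewrite rmorph1. Qed.

Lemma der_int (n : int) : xi n%:~R = 0.
Proof. by rewrite -(rmorph_int iota) der_const. Qed.

Lemma derN a : xi (- a) = - xi a.
Proof. by apply/eqP; rewrite -addr_eq0 -xiD addNr der0. Qed.

Lemma der_sum n (F : 'I_n -> K) : xi (\sum_i F i) = \sum_i xi (F i).
Proof. by apply: big_morph => //; apply: der0. Qed.

Lemma der_exp a n : a != 0 -> xi (a ^+ n) = n%:R * a ^+ n * (xi a / a).
Proof.
move=> a0; elim: n => [|n IH]; first by rewrite expr0 der1 !mul0r.
rewrite exprS derM IH -natr1; field; exact: a0.
Qed.

Lemma der_expz a (n : int) : a != 0 -> xi (a ^ n) = n%:~R * a ^ n * (xi a / a).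
Proof.
move=> a0; case: n => n; first exact: der_exp.
rewrite NegzE -exprnN mulrNz.
have an0 : a ^+ n.+1 != 0 by rewrite expf_neq0.
have := der1; rewrite -(mulfV an0) derM der_exp //= => /eqP.
rewrite addrC addr_eq0 => /eqP e; apply: (mulfI an0); rewrite e.
field; by rewrite an0 a0.
Qed.

Definition mapd u : {poly K} := map_poly xi u.

Lemma coef_mapd u i : (mapd u)`_i = xi u`_i.
Proof. by rewrite coef_map_id0 ?der0. Qed.

Lemma mapdD u v : mapd (u + v) = mapd u + mapd v.
Proof. by apply/polyP => i; rewrite coefD !coef_mapd coefD xiD. Qed.

Lemma mapdN u : mapd (- u) = - mapd u.
Proof. by apply/polyP => i; rewrite coefN !coef_mapd coefN derN. Qed.

Lemma mapdM u v : mapd (u * v) = mapd u * v + u * mapd v.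
Proof.
apply/polyP => i; rewrite coefD coef_mapd !coefM der_sum -big_split /=.
by apply: eq_bigr => j _; rewrite derM !coef_mapd.
Qed.

Lemma mapdC a : mapd a%:P = (xi a)%:P.
Proof. by apply/polyP => i; rewrite coef_mapd !coefC; case: eqP; rewrite ?der0. Qed.

Lemma mapdX : mapd 'X = 0.
Proof.
by apply/polyP => i; rewrite coef_mapd coefX coef0; case: eqP; rewrite ?der0 ?der1.
Qed.

Lemma mapdZ a u : mapd (a *: u) = xi a *: u + a *: mapd u.
Proof. by rewrite -mul_polyC mapdM mapdC !mul_polyC. Qed.

Lemma mapd_shift u (n : int) :
  mapd (u \Po ('X + (n%:~R)%:P)) = mapd u \Po ('X + (n%:~R)%:P).
Proof.
elim/poly_ind: u => [|u a IH]; first by rewrite comp_poly0 mapdC der0 comp_poly0.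
rewrite comp_polyD comp_polyM comp_polyX comp_polyC !mapdD !mapdM IH !mapdD.
rewrite !mapdX !mapdC der_int addr0 !mulr0 !addr0.
by rewrite comp_polyD comp_polyM comp_polyX comp_polyC.
Qed.

Context (f : K) (f_neq0 : f != 0).

Definition ders u : {poly K} := mapd u + (xi f / f) *: ('X * u).

Lemma dersD u v : ders (u + v) = ders u + ders v.
Proof. by rewrite /ders mapdD mulrDr scalerDr addrACA. Qed.

Lemma dersN u : ders (- u) = - ders u.
Proof. by rewrite /ders mapdN mulrN scalerN opprD. Qed.

Lemma ders0 : ders 0 = 0.
Proof. by rewrite /ders mapdC der0 mulr0 scaler0 addr0. Qed.

Lemma dersMl q u : mapd q = 0 -> ders (q * u) = q * ders u.
Proof. by move=> q0; rewrite /ders mapdM q0 -!mul_polyC; ring. Qed.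

Lemma dersC a : ders a%:P = (xi a)%:P + (a * (xi f / f)) *: 'X.
Proof. by rewrite /ders mapdC -!mul_polyC polyCM; ring. Qed.

Lemma ders_tpow n u : ders (tpow f n u) = tpow f n (ders u).
Proof.
rewrite /ders [in RHS]linearD [in RHS]linearZ_LR [in RHS]/= tpowX /tpow.
rewrite mapdZ mapd_shift der_expz //.
rewrite -!mul_polyC !polyCM; ring.
Qed.

Lemma ders_dt c u : xi c = 0 -> ders (dt f c u) = dt f c (ders u).
Proof.
move=> c0; rewrite /dt dersN dersMl ?ders_tpow //.
by rewrite mapdD mapdX mapdN mapdC c0 oppr0 addr0.
Qed.

Lemma ders_iter_dt c j u : xi c = 0 ->
  ders (iter j (dt f c) u) = iter j (dt f c) (ders u).
Proof. by move=> c0; elim: j => //= j IH; rewrite ders_dt // IH. Qed.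

(** On f^s itself d_t gives - (s - c) / f, so the twist c xi(f) / f cancels and s xi(f) / f is left:
    in the s-encoding derivations no longer see the twist. The general case follows since xi
    commutes with d_t. *)
Lemma Phi_der c u : xi c = 0 ->
  Phi f c (mapd u + (c * (xi f / f)) *: u - xi f *: ('X * u))
  = ders (Phi f c u).
Proof.
move=> c0; elim/poly_ind: u => [|u a IH].
  by rewrite mulr0 !scaler0 mapdC der0 !addr0 oppr0 addr0 linear0 ders0.
rewrite Phi_cons dersD ders_dt // -IH mapdD mapdM mapdX mulr0 addr0 !mapdC.
have -> : mapd u * 'X + (xi a)%:P + (c * (xi f / f)) *: (u * 'X + a%:P)
     - xi f *: ('X * (u * 'X + a%:P))
  = 'X * (mapd u + (c * (xi f / f)) *: u - xi f *: ('X * u))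
   + (xi a + c * (xi f / f) * a)%:P - (xi f * a) *: ('X * 1).
  by rewrite -!mul_polyC !(polyCD, polyCM); ring.
rewrite linearB linearD /= [Phi f c (_ *: _)]linearZ_LR /= !Phi_dt PhiC Phi1.
rewrite -addrA; congr (_ + _); rewrite dersC (dtC f c 1).
rewrite -!mul_polyC !(polyCD, polyCM).
have e : (xi f)%:P = (xi f * f^-1)%:P * f%:P :> {poly K}.
  by rewrite -polyCM divfK.
have e' : (f^-1)%:P * f%:P = 1 :> {poly K} by rewrite -polyCM mulVf.
rewrite e polyCM mulr1; ring: e'.
Qed.

End Derivations.

(** * D[s]-submodules and the lattices t^m D[s] f^s *)

Section Lattices.
Context {R : realType} {K : fieldType} (iota : {rmorphism R[i] -> K}).
Implicit Types (r h : R) (s : seq R).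

Definition rc : R -> K := iota \o real_complex R.
HB.instance Definition _ := GRing.RMorphism.copy rc (iota \o real_complex R).

(* A polynomial in s with real roots is recorded by the opposites of its roots, as
   s acts by - g on the graded piece of index g of a V-filtration. *)
Definition pol s : {poly K} := \prod_(h <- s) ('X + (rc h)%:P).

Lemma pol_nil : pol [::] = 1. Proof. exact: big_nil. Qed.

Lemma pol_cons h s : pol (h :: s) = ('X + (rc h)%:P) * pol s.
Proof. exact: big_cons. Qed.

Lemma pol_cat s s' : pol (s ++ s') = pol s * pol s'.
Proof. exact: big_cat. Qed.

Lemma pol_filter (P : pred R) s :
  pol s = pol (filter P s) * pol (filter (predC P) s).
Proof. by rewrite -pol_cat; apply: perm_big; rewrite perm_sym perm_filterC. Qed.

Lemma pol_shift s h : pol s \Po ('X + (rc h)%:P) = pol [seq a + h | a <- s].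
Proof.
rewrite /pol big_map rmorph_prod; apply: eq_bigr => a _ /=.
rewrite comp_polyD comp_polyX comp_polyC rmorphD polyCD; ring.
Qed.

Context (x : set K) (f : K).
Implicit Types (a b : K) (u v w q : {poly K}) (S N G : set {poly K}).

Local Notation Ds := (Ds_submodule iota x f).
Local Notation sDs := (smallest Ds).

Hypothesis hx : subalgebra iota x.

Lemma loc_const c : x (iota c). Proof. by case: hx. Qed.

Lemma loc_rc h : x (rc h). Proof. exact: loc_const. Qed.

Lemma loc0 : x 0. Proof. by rewrite -(rmorph0 rc); apply: loc_rc. Qed.

Lemma loc1 : x 1. Proof. by rewrite -(rmorph1 rc); apply: loc_rc. Qed.

Lemma loc_int (n : int) : x n%:~R.
Proof. by rewrite -(rmorph_int rc); apply: loc_rc. Qed.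

Lemma loc_nat n : x n%:R. Proof. exact: (loc_int n). Qed.

Lemma locB a b : x a -> x b -> x (a - b). Proof. by case: hx => _ + _; apply. Qed.

Lemma locN a : x a -> x (- a).
Proof. by move=> xa; rewrite -sub0r; apply: locB => //; apply: loc0. Qed.

Lemma locD a b : x a -> x b -> x (a + b).
Proof. by move=> xa xb; rewrite -[b]opprK; apply: locB => //; apply: locN. Qed.

Lemma locM a b : x a -> x b -> x (a * b). Proof. by case: hx => _ _; apply. Qed.

Lemma locX a n : x a -> x (a ^+ n).
Proof.
move=> xa; elim: n => [|n IH]; first by rewrite expr0; apply: loc1.
by rewrite exprS; apply: locM.
Qed.

Lemma loc_sum n (F : 'I_n -> K) : (forall i, x (F i)) -> x (\sum_i F i).
Proof.
by move=> xF; elim/big_ind: _ => // [|a b]; [apply: loc0 | apply: locD].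
Qed.

Section Closure.
Variable (N : set {poly K}) (DN : Ds N).

Lemma Ds0 : N 0. Proof. by case: DN => -[]. Qed.

Lemma DsD u v : N u -> N v -> N (u + v).
Proof. by case: DN => -[_ + _ _ _]; apply. Qed.

Lemma DsZ a u : x a -> N u -> N (a *: u).
Proof. by case: DN => _ + _ _; apply. Qed.

Lemma DsX u : N u -> N ('X * u). Proof. by case: DN => _ _ + _; apply. Qed.

Lemma Ds_der xi u : derivation_at iota x xi -> N u -> N (ders xi f u).
Proof. by case: DN => _ _ _; apply. Qed.

Lemma DsN u : N u -> N (- u).
Proof. by move=> Nu; rewrite -scaleN1r; apply: DsZ => //; apply: locN loc1. Qed.

Lemma DsB u v : N u -> N v -> N (u - v).
Proof. by move=> Nu Nv; apply: DsD => //; apply: DsN. Qed.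

Lemma DsXh h u : N u -> N (('X + (rc h)%:P) * u).
Proof.
move=> Nu; rewrite mulrDl mul_polyC; apply: DsD; first exact: DsX.
by apply: DsZ => //; apply: loc_rc.
Qed.

Lemma Ds_pol s u : N u -> N (pol s * u).
Proof.
move=> Nu; elim: s => [|h s IH]; first by rewrite pol_nil mul1r.
by rewrite pol_cons -mulrA; apply: DsXh.
Qed.

Lemma Ds_sum n (F : 'I_n -> {poly K}) : (forall i, N (F i)) -> N (\sum_i F i).
Proof.
by move=> xF; elim/big_ind: _ => // [|u v]; [apply: Ds0 | apply: DsD].
Qed.

Lemma Ds_coprime1 h s w : h \notin s ->
  N (('X + (rc h)%:P) * w) -> N (pol s * w) -> N w.
Proof.
move=> + Nh; elim: s => [_|h' s IH]; first by rewrite pol_nil mul1r.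
rewrite inE negb_or => /andP[hh' hs]; rewrite pol_cons -mulrA => Ns.
apply: IH => //.
have : N (rc (h - h')^-1 *: (('X + (rc h)%:P) * (pol s * w)
           - ('X + (rc h')%:P) * (pol s * w))).
  apply: DsZ; [exact: loc_rc|apply: DsB => //].
  by rewrite mulrCA; apply: Ds_pol.
suff -> : rc (h - h')^-1 *: (('X + (rc h)%:P) * (pol s * w)
           - ('X + (rc h')%:P) * (pol s * w)) = pol s * w by [].
rewrite -mulrBl opprD addrACA subrr add0r -polyCB -rmorphB mul_polyC scalerA.
by rewrite -rmorphM mulVf ?rmorph1 ?scale1r // subr_eq0.
Qed.

(** Bezout for polynomials without a common root: two factors s + h and s + h' differ by a nonzero
    constant, whose inverse acts on N. *)
Lemma Ds_coprime s s' w : {in s, forall h, h \notin s'} ->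
  N (pol s * w) -> N (pol s' * w) -> N w.
Proof.
elim: s w => [|h s IH] w hs; first by rewrite pol_nil mul1r.
rewrite pol_cons mulrAC mulrC => N1 N2.
apply: (@Ds_coprime1 h s') => //; first by apply: hs; rewrite mem_head.
apply: IH => // [h' h's|]; first by apply: hs; rewrite inE h's orbT.
by rewrite mulrCA; apply: DsXh.
Qed.

End Closure.

Lemma sDs_Ds G : Ds (sDs G).
Proof.
split.
- split=> [N [/Ds0 //]|u v hu hv N NG].
  by apply: DsD; [case: NG|apply: hu|apply: hv].
- by move=> a u xa hu N NG; apply: DsZ => //; [case: NG|apply: hu].
- by move=> u hu N NG; apply: DsX; [case: NG|apply: hu].
- by move=> xi u hxi hu N NG; apply: Ds_der => //; [case: NG|apply: hu].
Qed.

(* Preimages of D[s]-submodules under these maps are again D[s]-submodules; s need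
   only be preserved up to a translation. *)
Definition Ds_op (T : {poly K} -> {poly K}) :=
  [/\ forall u v, T (u + v) = T u + T v,
      forall a u, T (a *: u) = a *: T u,
      exists h, forall u, T ('X * u) = ('X + (rc h)%:P) * T u
    & forall xi u, derivation_at iota x xi ->
        T (ders xi f u) = ders xi f (T u)].

Lemma Ds_preimage T N : Ds_op T -> Ds N -> Ds (T @^-1` N).
Proof.
move=> [TD TZ [h TX] Tder] DN; split.
- split=> [|u v]; rewrite /preimage /=; last by rewrite TD; apply: DsD.
  by rewrite -(scale0r 0) TZ scale0r; apply: Ds0.
- by move=> a u xa; rewrite /preimage /= TZ; apply: DsZ.
- by move=> u; rewrite /preimage /= TX; apply: DsXh.
- by move=> xi u hxi Nu; rewrite /preimage /= Tder //; apply: Ds_der.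
Qed.

Lemma Ds_op_sub T G N : Ds_op T -> Ds N -> (forall u, G u -> N (T u)) ->
  forall u, sDs G u -> N (T u).
Proof.
move=> hT DN GN; apply: smallest_sub; last exact: GN.
exact: Ds_preimage.
Qed.

Lemma sDs_sub G N : Ds N -> (forall u, G u -> N u) -> forall u, sDs G u -> N u.
Proof. by move=> DN GN; apply: smallest_sub. Qed.

Hypothesis f_neq0 : f != 0.
Hypothesis xf : x f.

Lemma Ds_op_tpow n : Ds_op (tpow f n).
Proof.
split=> [u v|a u||xi u hxi].
- exact: tpow_add.
- exact: tpow_scale.
- by exists n%:~R => u; rewrite tpowX (rmorph_int rc).
- by rewrite (ders_tpow hxi).
Qed.

Lemma Ds_op_dt h : Ds_op (dt f (rc h)).
Proof.
split=> [u v|a u||xi u hxi].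
- exact: dt_add.
- exact: dt_scale.
- by exists (-1) => u; rewrite dtX rmorphN1 (polyCN 1).
- by rewrite (ders_dt hxi) //; apply: der_const hxi _.
Qed.

Lemma Ds_op_comp T1 T2 : Ds_op T1 -> Ds_op T2 -> Ds_op (T1 \o T2).
Proof.
move=> [D1 Z1 [h1 X1] der1] [D2 Z2 [h2 X2] der2].
split=> [u v|a u||xi u hxi] /=.
- by rewrite D2 D1.
- by rewrite Z2 Z1.
- exists (h1 + h2) => u; rewrite X2 mulrDl D1 X1 mul_polyC Z1 rmorphD polyCD.
  by rewrite -mul_polyC; ring.
- by rewrite der2 // der1.
Qed.

Lemma Ds_op_iter_dt h j : Ds_op (iter j (dt f (rc h))).
Proof.
elim: j => [|j IH]; last exact: Ds_op_comp (Ds_op_dt h) IH.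
by split=> //; exists 0 => u; rewrite (rmorph0 rc) addr0.
Qed.

Lemma mapd_pol xi s : derivation_at iota x xi -> mapd xi (pol s) = 0.
Proof.
move=> hxi; elim: s => [|h s IH]; first by rewrite pol_nil (mapdC hxi) (der1 hxi).
rewrite pol_cons (mapdM hxi) IH mulr0 addr0 (mapdD hxi) (mapdX hxi) (mapdC hxi).
by rewrite (der_const hxi) addr0 mul0r.
Qed.

Lemma Ds_op_pol s : Ds_op ( *%R (pol s)).
Proof.
split=> [u v|a u||xi u hxi].
- by rewrite mulrDr.
- by rewrite scalerAr.
- by exists 0 => u; rewrite rmorph0 addr0 mulrCA.
- by rewrite (dersMl hxi) // (mapd_pol _ hxi).
Qed.

Lemma tpow_pol n s w :
  tpow f n (pol s * w) = pol [seq h + n%:~R | h <- s] * tpow f n w.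
Proof. by rewrite tpowM -(rmorph_int rc) pol_shift. Qed.

(* The lattice t^m D_{X,x}[s] f^s. *)
Definition Lat (m : int) w := sDs [set 1] (tpow f (- m) w).

Lemma Lat_Ds m : Ds (Lat m).
Proof. exact: (Ds_preimage (Ds_op_tpow (- m)) (sDs_Ds _)). Qed.

Lemma Lat_tpow m n w : Lat (m + n) (tpow f n w) <-> Lat m w.
Proof. by rewrite /Lat tpowD // opprD -addrA addNr addr0. Qed.

Lemma Lat01 : Lat 0 1.
Proof. by rewrite /Lat oppr0 tpow0; apply: sub_gen_smallest. Qed.

Lemma Lat_sub m N : Ds N -> N (tpow f m 1) -> forall w, Lat m w -> N w.
Proof.
move=> DN N1 w hw; rewrite -(tpowNK f_neq0 m w).
by move: hw; apply: (Ds_op_sub (Ds_op_tpow m)) => // u ->.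
Qed.

Lemma Lat1f : Lat 1 f%:P.
Proof.
rewrite /Lat tpowC exprN1 mulVf //; exact: sub_gen_smallest.
Qed.

Lemma Lat0_tpow m w : Lat m (tpow f m w) <-> Lat 0 w.
Proof. by have := Lat_tpow 0 m w; rewrite add0r. Qed.

Lemma Lat_succ m w : Lat (m + 1) w -> Lat m w.
Proof.
apply: Lat_sub; first exact: Lat_Ds.
rewrite -tpowD // Lat0_tpow (tpowC f 1 1) mulr1 -[_%:P]mulr1 mul_polyC.
by apply: (DsZ (Lat_Ds 0)) => //; apply: Lat01.
Qed.

Lemma Lat_le m n w : m <= n -> Lat n w -> Lat m w.
Proof.
move=> mn; have [k ->] : exists k : nat, n = m + k%:Z.
  by exists `|(n - m)%R|%N; rewrite gez0_abs ?subr_ge0 //; ring.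
elim: k w => [|k IH] w; first by rewrite addr0.
by rewrite -addn1 PoszD addrA => /Lat_succ /IH.
Qed.

Lemma Lat_dt m h w : Lat m w -> Lat (m - 1) (dt f (rc h) w).
Proof.
move=> Lw; rewrite /dt -polyCN -rmorphN -mulrN -linearN.
apply: (DsXh (Lat_Ds _)); rewrite Lat_tpow; exact: (DsN (Lat_Ds _)).
Qed.

Lemma Lat_iter_dt m h j w :
  Lat m w -> Lat (m - j%:Z) (iter j (dt f (rc h)) w).
Proof.
move=> Lw; elim: j => [|j IH]; first by rewrite subr0.
by rewrite -addn1 PoszD opprD addrA addn1; apply: Lat_dt.
Qed.

(** * Polynomials in s with coefficients in O_X( *Z) *)

Definition pole_poly u := forall j, poles x f u`_j.

Lemma polesB a b : poles x f a -> poles x f b -> poles x f (a - b).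
Proof.
move=> [n ha] [m hb]; exists (n + m)%N; rewrite mulrBl exprD.
apply: locB; first by rewrite mulrA; apply: locM => //; apply: locX.
by rewrite mulrCA; apply: locM => //; apply: locX.
Qed.

Lemma poles_loc a : x a -> poles x f a.
Proof. by exists 0; rewrite mulr1. Qed.

Lemma poles0 : poles x f 0. Proof. exact: poles_loc loc0. Qed.

Lemma polesD a b : poles x f a -> poles x f b -> poles x f (a + b).
Proof.
move=> pa pb; rewrite -[b]opprK; apply: polesB => //.
by rewrite -sub0r; apply: polesB => //; apply: poles0.
Qed.

Lemma polesM a b : poles x f a -> poles x f b -> poles x f (a * b).
Proof.
move=> [n ha] [m hb]; exists (n + m)%N; rewrite exprD mulrACA.
exact: locM.
Qed.

Lemma poles_exp n : poles x f (f ^ n).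
Proof.
case: n => n; first by apply: poles_loc; apply: locX.
by exists n.+1; rewrite NegzE -exprnN mulVf ?expf_neq0 //; apply: loc1.
Qed.

Lemma poles_inv : poles x f f^-1.
Proof. by have := poles_exp (-1); rewrite exprN1. Qed.

Lemma poles_sum n (F : 'I_n -> K) :
  (forall i, poles x f (F i)) -> poles x f (\sum_i F i).
Proof.
by move=> xF; elim/big_ind: _ => // [|a b]; [apply: poles0 | apply: polesD].
Qed.

Lemma poles_der xi a : derivation_at iota x xi -> poles x f a -> poles x f (xi a).
Proof.
move=> hxi [n ha]; exists n.+1.
have xider b : x b -> x (xi b) by case: hxi => _ _ _; apply.
have -> : xi a * f ^+ n.+1 = xi (a * f ^+ n) * f - n%:R * (a * f ^+ n) * xi f.
  by rewrite (derM hxi) (der_exp hxi) // exprS; field.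
apply: locB; first by apply: locM => //; apply: xider.
by apply: locM; [apply: locM => //; apply: loc_nat | apply: xider].
Qed.

Lemma pole_polyC a : poles x f a -> pole_poly a%:P.
Proof. by move=> pa j; rewrite coefC; case: eqP => // _; apply: poles0. Qed.

Lemma pole_poly0 : pole_poly 0.
Proof. by move=> j; rewrite coef0; apply: poles0. Qed.

Lemma pole_polyX : pole_poly 'X.
Proof. by move=> j; rewrite coefX; apply: poles_loc; apply: loc_nat. Qed.

Lemma pole_polyD u v : pole_poly u -> pole_poly v -> pole_poly (u + v).
Proof. by move=> hu hv j; rewrite coefD; apply: polesD. Qed.

Lemma pole_polyM u v : pole_poly u -> pole_poly v -> pole_poly (u * v).
Proof. by move=> hu hv j; rewrite coefM; apply: poles_sum => i; apply: polesM. Qed.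

Lemma pole_polyZ a u : poles x f a -> pole_poly u -> pole_poly (a *: u).
Proof. by move=> pa hu j; rewrite coefZ; apply: polesM. Qed.

Lemma pole_polyN u : pole_poly u -> pole_poly (- u).
Proof. by move=> hu j; rewrite coefN -sub0r; apply: polesB => //; apply: poles0. Qed.

Lemma pole_poly_cons u a :
  pole_poly (u * 'X + a%:P) <-> pole_poly u /\ poles x f a.
Proof.
split=> [h|[hu ha]].
  split; last by have := h 0%N; rewrite coefD coefMX coefC /= add0r.
  by move=> j; have := h j.+1; rewrite coefD coefMX coefC /= addr0.
by apply: pole_polyD; [apply: pole_polyM => //; apply: pole_polyX | apply: pole_polyC].
Qed.

Lemma pole_poly_Xh h : pole_poly ('X + (rc h)%:P).
Proof.
apply: pole_polyD; [exact: pole_polyX|apply/pole_polyC/poles_loc/loc_rc].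
Qed.

Lemma pole_poly_tpow n u : pole_poly u -> pole_poly (tpow f n u).
Proof.
move=> pu; apply: pole_polyZ; first exact: poles_exp.
elim/poly_ind: u pu => [|u a IH] pu.
  by rewrite comp_poly0; apply: pole_poly0.
move/pole_poly_cons: pu => [/IH pu pa].
rewrite comp_polyD comp_polyM comp_polyX comp_polyC.
apply: pole_polyD; last exact: pole_polyC.
by apply: pole_polyM => //; rewrite -(rmorph_int rc); apply: pole_poly_Xh.
Qed.

Lemma pole_poly_dt h u : pole_poly u -> pole_poly (dt f (rc h) u).
Proof.
move=> pu; rewrite /dt -polyCN -rmorphN; apply/pole_polyN/pole_polyM.
  exact: pole_poly_Xh.
exact: pole_poly_tpow.
Qed.

Lemma pole_poly_Ds : Ds pole_poly.
Proof.
split.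
- split; [by apply: pole_poly0 | exact: pole_polyD].
- by move=> a u xa pu; apply: pole_polyZ => //; apply: poles_loc.
- by move=> u pu; apply: pole_polyM => //; apply: pole_polyX.
- move=> xi u hxi pu; apply: pole_polyD.
    by move=> j; rewrite (coef_mapd hxi); apply: poles_der.
  apply: pole_polyZ; last by apply: pole_polyM => //; apply: pole_polyX.
  apply: polesM; last exact: poles_inv.
  by apply: poles_der => //; apply: poles_loc.
Qed.

Lemma pole_poly1 : pole_poly 1.
Proof. by apply: (pole_polyC (a := 1)); apply/poles_loc/loc1. Qed.

Lemma Lat_pole_poly m w : Lat m w -> pole_poly w.
Proof.
by apply: Lat_sub; [exact: pole_poly_Ds|apply/pole_poly_tpow/pole_poly1].
Qed.

Lemma pole_poly_Lat w : pole_poly w -> exists m, Lat m w.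
Proof.
elim/poly_ind: w => [|w a IH] pw; first by exists 0; apply: (Ds0 (Lat_Ds 0)).
move/pole_poly_cons: pw => [/IH [m Lw] [n an]].
exists (Num.min m (- n%:Z)); apply: (DsD (Lat_Ds _)).
  rewrite mulrC; apply: (DsX (Lat_Ds _)).
  by apply: Lat_le Lw; rewrite ge_min lexx.
apply: (@Lat_le _ (- n%:Z)); first by rewrite ge_min lexx orbT.
have -> : a%:P = (a * f ^+ n) *: tpow f (- n%:Z) 1.
  rewrite (tpowC f _ 1) mulr1 -mul_polyC -polyCM -exprnN.
  by rewrite mulfK ?expf_neq0.
by apply: (DsZ (Lat_Ds _)) => //; rewrite Lat0_tpow; apply: Lat01.
Qed.

(** Synthetic division: the coefficients of the quotient are recovered from the top one downwards,
    by additions and multiplications by [a] only. *)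
Lemma pole_poly_divX a q : poles x f a ->
  pole_poly (q * ('X - a%:P)) -> pole_poly q.
Proof.
move=> pa pq.
have H d j : (size q <= j + d)%N -> poles x f q`_j.
  elim: d j => [|d IH] j.
    by rewrite addn0 => h; rewrite nth_default //; apply: poles0.
  move=> h; have {}IH : poles x f q`_j.+1 by apply: IH; rewrite addSnnS.
  have -> : q`_j = (q * ('X - a%:P))`_j.+1 + a * q`_j.+1.
    by rewrite mulrBr coefB coefMX coefMC /= mulrC subrK.
  by apply: polesD => //; apply: polesM.
by move=> j; apply: (H (size q)); rewrite leq_addl.
Qed.

(** Write w = (s - h) q + w(h). Then (s - h) q is d_t applied to - t q, and q has smaller degree
    than w, so induction on the degree in s applies. *)
Lemma Phi_surj h w : pole_poly w ->
  exists u, pole_poly u /\ Phi f (rc h) u = w.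
Proof.
have [n] := ubnP (size w); elim: n w => // n IH w; rewrite ltnS => sw pw.
set a := w.[rc h].
have /factor_theorem [q qE] : root (w - a%:P) (rc h).
  by rewrite /root hornerD hornerN hornerC subrr.
have pa : poles x f a.
  rewrite /a; elim/poly_ind: w {IH sw a q qE} pw => [_|w b IH].
    by rewrite horner0; apply: poles0.
  move=> /pole_poly_cons [pw pb]; rewrite hornerMXaddC; apply: polesD => //.
  by apply: polesM; [apply: IH | apply/poles_loc/loc_rc].
have pq : pole_poly q.
  apply: (@pole_poly_divX (rc h)); first exact/poles_loc/loc_rc.
  by rewrite -qE; apply: pole_polyD => //; apply/pole_polyN/pole_polyC.
have wE : w = q * ('X - (rc h)%:P) + a%:P by rewrite -qE subrK.
have [u [pu uE]] : exists u, pole_poly u /\ Phi f (rc h) u = - tpow f 1 q.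
  have [->|q0] := eqVneq q 0.
    exists 0; split; first exact: pole_poly0.
    by rewrite !linear0.
  apply: IH; last by apply/pole_polyN/pole_poly_tpow.
  rewrite size_polyN size_tpow //; apply: leq_trans sw.
  have sq : size (q * ('X - (rc h)%:P)) = (size q).+1.
    by rewrite size_Mmonic ?monicXsubC // size_XsubC addn2.
  rewrite wE size_polyDl sq //.
  by rewrite (leq_ltn_trans (size_polyC_leq1 _)) // ltnS lt0n size_poly_eq0.
exists (u * 'X + a%:P); split; first exact/pole_poly_cons.
by rewrite Phi_cons uE -scaleN1r dt_scale dt_tpow // scaleN1r opprK wE mulrC.
Qed.

End Lattices.

(** * The V-filtration of O_X( *Z)[s] f^s *)

(** The integer translates of finitely many reals form a discrete set; this makes the jumps of the
    V-filtration discrete. For a single [a] only the integers next to g - a, below and above,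
    matter. *)
Lemma seq_isolated {R : realType} (s : seq R) (g : R) :
  exists2 e : R, 0 < e & forall a (k : int), a \in s ->
    a + k%:~R != g -> e <= `|a + k%:~R - g|.
Proof.
elim: s => [|a s [e e0 He]]; first by exists 1.
set d := Num.floor (g - a).
have hd : d%:~R <= g - a by exact: floor_le_tmp.
have hd1 : g - a < (d + 1)%:~R by exact: floorD1_gt.
have [e' e'0 He'] : exists2 e' : R, 0 < e' & forall k : int,
    a + k%:~R != g -> e' <= `|a + k%:~R - g|.
  have [E|E] := eqVneq (d%:~R) (g - a).
    exists 1 => // k kg.
    have -> : a + k%:~R - g = (k - d)%:~R by rewrite intrD rmorphN /= E; ring.
    rewrite -intr_norm ler1z -gtz0_ge1 normr_gt0 subr_eq0.
    by apply: contraNneq kg => ->; rewrite E addrC subrK.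
  exists (Num.min (g - a - d%:~R) ((d + 1)%:~R - (g - a))).
    by rewrite lt_min !subr_gt0 hd1 andbT lt_neqAle E hd.
  move=> k _; rewrite ge_min; apply/orP.
  have [kd|dk] := leP k d; [left|right].
    have : k%:~R <= d%:~R :> R by rewrite ler_int.
    by move=> h; rewrite ler0_norm; lra.
  have : (d + 1)%:~R <= k%:~R :> R by rewrite ler_int lezD1.
  by move=> h; rewrite ger0_norm; lra.
exists (Num.min e e'); first by rewrite lt_min e0.
move=> b k; rewrite inE => /orP[/eqP ->|bs] h; rewrite ge_min.
  by rewrite He' ?orbT.
by rewrite He.
Qed.

Lemma seq_bounded {R : realType} (s : seq R) :
  exists B : R, forall a, a \in s -> `|a| <= B.
Proof.
elim: s => [|a s [B HB]]; first by exists 0.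
exists (Num.max `|a| B) => b; rewrite inE => /orP[/eqP ->|/HB h].
  by rewrite le_max lexx.
by rewrite le_max h orbT.
Qed.

Section VFiltration.
Context {R : realType} {K : fieldType} (iota : {rmorphism R[i] -> K}).
Context (x : set K) (f : K).
Hypothesis hx : subalgebra iota x.
Hypothesis f_neq0 : f != 0.
Hypothesis xf : x f.
Implicit Types (u v w : {poly K}) (g h a : R) (s : seq R).

Local Notation rc := (rc iota).
Local Notation pol := (pol iota).
Local Notation Lat := (Lat iota x f).

(* The elements which, modulo every t^m L, are sums of generalized eigenvectors of
   s for eigenvalues at most - g. *)
Definition VM g w := (exists c, Lat c w) /\
  forall m : int, exists s, all (>= g) s /\ Lat m (pol s * w).

Lemma LatDs m : Ds_submodule iota x f (Lat m).
Proof. exact: Lat_Ds. Qed.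

Lemma Lat_lower c w (n : int) : Lat c w -> exists d : nat, Lat (n - d%:Z) w.
Proof. by move=> Lw; exists `|(n - c)%R|%N; apply: Lat_le Lw => //; lia. Qed.

Lemma VM_Ds g : Ds_submodule iota x f (VM g).
Proof.
split.
- split=> [|u v [[c Lu] Hu] [[d Lv] Hv]].
    split=> [|m]; first by exists 0; apply: (Ds0 (LatDs 0)).
    by exists [::]; split=> //; rewrite mulr0; apply: (Ds0 (LatDs m)).
  split=> [|m].
    exists (Num.min c d); apply: (DsD (LatDs _)).
      by apply: Lat_le Lu => //; rewrite ge_min lexx.
    by apply: Lat_le Lv => //; rewrite ge_min lexx orbT.
  have [s [hs Ls]] := Hu m; have [s' [hs' Ls']] := Hv m.
  exists (s ++ s'); split; first by rewrite all_cat hs.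
  rewrite pol_cat mulrDr; apply: (DsD (LatDs _)).
    by rewrite mulrAC mulrC; apply: (Ds_pol hx (LatDs _)).
  by rewrite -mulrA; apply: (Ds_pol hx (LatDs _)).
- move=> a u xa [[c Lu] Hu]; split=> [|m].
    by exists c; apply: (DsZ (LatDs _)).
  have [s [hs Ls]] := Hu m; exists s; split=> //.
  by rewrite -scalerAr; apply: (DsZ (LatDs _)).
- move=> u [[c Lu] Hu]; split=> [|m].
    by exists c; apply: (DsX (LatDs _)).
  have [s [hs Ls]] := Hu m; exists s; split=> //.
  by rewrite mulrCA; apply: (DsX (LatDs _)).
- move=> xi u hxi [[c Lu] Hu]; split=> [|m].
    by exists c; apply: (Ds_der (LatDs _)).
  have [s [hs Ls]] := Hu m; exists s; split=> //.
  have [_ _ _] := Ds_op_pol iota x f s => /(_ xi u hxi) e.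
  by rewrite -[_ + _]/(ders xi f u) e; apply: (Ds_der (LatDs _)).
Qed.

Lemma VM_le g h w : g <= h -> VM h w -> VM g w.
Proof.
move=> gh [Lw Hw]; split=> // m; have [s [hs Ls]] := Hw m; exists s; split=> //.
by apply: sub_all hs => a; apply: le_trans.
Qed.

Lemma VM_tpow g (n : int) w : VM g w -> VM (g + n%:~R) (tpow f n w).
Proof.
move=> [[c Lw] Hw]; split=> [|m]; first by exists (c + n); apply/Lat_tpow.
have [s [hs Ls]] := Hw (m - n); exists [seq h + n%:~R | h <- s]; split.
  by apply/allP => _ /mapP[h /(allP hs) /= gh ->]; rewrite lerD2r.
by rewrite -tpow_pol -[m](subrK n); apply/Lat_tpow.
Qed.

Lemma VM_dt g h w : VM g w -> VM (g - 1) (dt f (rc h) w).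
Proof.
move=> Vw; rewrite /dt -polyCN -rmorphN -mulrN.
apply: (DsXh hx (VM_Ds _)); apply: (DsN hx (VM_Ds _)).
by have := VM_tpow (-1) Vw; rewrite rmorphN1.
Qed.

Lemma VM_pol g s w c : all (>= g) s -> Lat c w -> VM g (pol s * w) -> VM g w.
Proof.
move=> hs Lw [_ H]; split=> [|m]; first by exists c.
have [s' [hs' Ls]] := H m; exists (s' ++ s); rewrite all_cat hs' hs.
by split=> //; rewrite pol_cat -mulrA.
Qed.

Lemma VM_pole_poly g w : VM g w -> pole_poly x f w.
Proof. by move=> [[c Lw] _]; apply: Lat_pole_poly Lw. Qed.

Context (bs : seq R).
Hypothesis hbs : Lat 1 (pol bs).

(** Conjugation by t^m translates s by m, so that b(s) L in t L becomes b(s + m) t^m L in t^(m + 1)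
    L, with b = [pol bs]. *)
Lemma Lat_bs m w : Lat m w -> Lat (m + 1) (pol [seq h + m%:~R | h <- bs] * w).
Proof.
move=> Lw; rewrite -(tpowNK f_neq0 m w) -tpow_pol addrC; apply/Lat_tpow => //.
have : Lat 0 (tpow f (- m) w) by rewrite -(Lat_tpow _ _ f_neq0 0 m) add0r tpowNK.
have D := Ds_preimage hx (Ds_op_pol iota x f bs) (LatDs 1).
by apply: (Lat_sub hx f_neq0 D); rewrite /preimage /= tpow0 mulr1.
Qed.

(* The product of the b(s + j), c <= j < c + n, kills t^c L / t^(c+n) L. *)
Definition Tot (c : int) (n : nat) :=
  flatten (mkseq (fun k => [seq h + (c + k%:Z)%:~R | h <- bs]) n).

Lemma TotS c n : Tot c n.+1 = Tot c n ++ [seq h + (c + n%:Z)%:~R | h <- bs].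
Proof. by rewrite /Tot /mkseq -addn1 iotaD map_cat flatten_cat /= cats0. Qed.

Lemma TotP c n a : a \in Tot c n ->
  exists2 h, h \in bs & exists2 k : int, c <= k < c + n%:Z & a = h + k%:~R.
Proof.
move=> /flattenP[s /mapP[k + ->] /mapP[h hb ->]]; rewrite mem_iota => kn.
by exists h => //; exists (c + k%:Z) => //; lia.
Qed.

Lemma Lat_Tot c n w : Lat c w -> Lat (c + n%:Z) (pol (Tot c n) * w).
Proof.
move=> Lw; elim: n => [|n IH]; first by rewrite addr0 pol_nil mul1r.
rewrite TotS pol_cat [pol (Tot _ _) * _]mulrC -mulrA.
by rewrite -addn1 PoszD addrA; apply: Lat_bs.
Qed.

Lemma VM_Lat g m w : (forall h, h \in bs -> g <= h + m%:~R) ->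
  Lat m w -> VM g w.
Proof.
move=> hg Lw; split=> [|M]; first by exists m.
exists (Tot m `|(M - m)%R|%N); split; last first.
  by apply: Lat_le (Lat_Tot _ Lw) => //; lia.
apply/allP => a /TotP[h /hg gh [k /andP[mk _] ->]] /=.
by apply: le_trans gh _; rewrite lerD2l ler_int.
Qed.

(** Some t^(c - d) L contains w, and [Tot] carries it into t^c L. The entries of this [Tot] are all
    < g, those given by membership in [VM g] are all >= g, so Bezout applies. *)
Lemma VM_Lat_lower g (c : int) w :
  (forall h (k : int), h \in bs -> k < c -> h + k%:~R < g) ->
  VM g w -> Lat c w.
Proof.
move=> hg [[c' Lw] H]; have [d Ld] := Lat_lower c Lw.
have [s [hs Ls]] := H c; have := Lat_Tot d Ld; rewrite subrK.
apply: (Ds_coprime hx (LatDs c)) Ls => a /(allP hs) /= ga.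
apply/negP => /TotP[h hb [k /andP[_ kc] ae]].
have : h + k%:~R < g by apply: hg => //; lia.
by rewrite -ae ltNge ga.
Qed.

Variable N : nat.

Lemma VM_char g w : (forall h, h \in bs -> `|h| + `|g| < N%:R) ->
  VM g w <-> Lat (- N%:Z) w /\
    Lat N%:Z (pol (filter (>= g) (Tot (- N%:Z) (N + N))) * w).
Proof.
move=> hN.
have hlow h (k : int) : h \in bs -> k < - N%:Z -> h + k%:~R < g.
  move=> /hN h1 kN; have : k%:~R < (- N%:Z)%:~R :> R by rewrite ltr_int.
  rewrite rmorphN /= -pmulrn.
  have := ler_norm h; have := ler_norm (- g); rewrite normrN; lra.
have hup h : h \in bs -> g <= h + N%:R.
  move=> /hN h1; have := ler_norm g; have := ler_norm (- h).
  rewrite normrN; lra.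
set T := Tot _ _.
split=> [Vw|[L1 L2]].
  have L1 : Lat (- N%:Z) w by apply: VM_Lat_lower Vw.
  split=> //; have := Lat_Tot (N + N) L1; rewrite -/T.
  have -> : - N%:Z + (N + N)%N%:Z = N%:Z by lia.
  rewrite (pol_filter iota (>= g)) mulrAC mulrC => L2.
  have [_ /(_ N) [s [hs Ls]]] := Vw.
  apply: (Ds_coprime hx (LatDs _)) L2; last first.
    by rewrite mulrCA; apply: (Ds_pol hx (LatDs _)) Ls.
  by move=> a /(allP hs) /= ga; rewrite mem_filter /= ga.
apply: (VM_pol _ L1 (s := filter (>= g) T)); first exact: filter_all.
by apply: VM_Lat L2.
Qed.

Lemma VM_eq g h w : (forall a, a \in bs -> `|a| + `|g| < N%:R) ->
    (forall a, a \in bs -> `|a| + `|h| < N%:R) ->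
    (forall a (k : int), a \in bs -> (g <= a + k%:~R) = (h <= a + k%:~R)) ->
  VM g w <-> VM h w.
Proof.
move=> hg hh gh; rewrite !VM_char // (@eq_in_filter _ _ (>= h)) // => a.
by move=> /TotP[c cb [k _ ->]] /=; apply: gh.
Qed.

Lemma pol_pred1 g s : pol (filter (pred1 g) s) = pol (nseq (count_mem g s) g).
Proof. by elim: s => //= a s IH; case: eqP => [->|_] //=; rewrite !pol_cons IH. Qed.

Definition nilp_index g := count_mem g (filter (>= g) (Tot (- N%:Z) (N + N))).

(** No translate of an entry of [bs] other than g itself separates g from h, so the finite tests for
    g and for h differ only by a power of s + g. *)
Lemma VM_nilpotent g h n w : (forall a, a \in bs -> `|a| + `|g| < N%:R) ->
    (forall a, a \in bs -> `|a| + `|h| < N%:R) -> g < h ->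
    (forall a (k : int), a \in bs -> a + k%:~R != g ->
       (g <= a + k%:~R) = (h <= a + k%:~R)) ->
    (nilp_index g <= n)%N ->
  VM g w -> VM h (pol (nseq n g) * w).
Proof.
move=> hg hh lt_gh gh hn /(VM_char _ hg) [L1 L2]; apply/(VM_char _ hh).
split; first exact: (Ds_pol hx (LatDs _)).
move: L2; rewrite (pol_filter iota (pred1 g)) pol_pred1 -/(nilp_index g).
rewrite -filter_predI (@eq_in_filter _ _ (>= h)).
  rewrite -(subnK hn) nseqD pol_cat => L2.
  rewrite mulrCA -mulrA; apply: (Ds_pol hx (LatDs _)).
  by rewrite mulrA.
move=> a /TotP[c cb [k _ ->]] /=; case: eqP => [->|/eqP ne] /=.
  by rewrite leNgt lt_gh.
exact: gh.
Qed.

Lemma VM_exhaustive w : pole_poly x f w -> exists g, VM g w.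
Proof.
move=> /(pole_poly_Lat hx f_neq0 xf) [m Lm].
have [B HB] := seq_bounded bs; exists (m%:~R - B); apply: VM_Lat Lm => h /HB.
have := ler_norm (- h); rewrite normrN; lra.
Qed.

End VFiltration.

(** * The V-filtration of the graph module *)

Section GraphModule.
Context {R : realType} {K : fieldType} (iota : {rmorphism R[i] -> K}).
Context (x : set K) (f : K).
Hypothesis hx : subalgebra iota x.
Hypothesis f_neq0 : f != 0.
Hypothesis xf : x f.
Context (l : nat) (beta : rat).
Local Notation E := {ffun 'I_l -> {poly K}}.
Local Notation rc := (rc iota).
Local Notation pol := (pol iota).
Implicit Types (u v : E) (w : {poly K}) (i : 'I_l) (g h a : R).

Definition twist i : R := i%:R * ratr beta.

Lemma rc_twist i : rc (twist i) = i%:R * ratr beta :> K.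
Proof. by rewrite rmorphM rmorph_nat /= fmorph_rat. Qed.

(* Identifies y^i delta with f^s, so that - d_t t acts as s - i beta. *)
Definition PhiE u i : {poly K} := Phi f (rc (twist i)) (u i).

Lemma PhiE_add u v i : PhiE (u + v) i = PhiE u i + PhiE v i.
Proof. by rewrite /PhiE ffunE Phi_add. Qed.

Lemma PhiE_0 i : PhiE 0 i = 0.
Proof. by rewrite /PhiE ffunE linear0. Qed.

Lemma PhiE_sum n (F : 'I_n -> E) i : PhiE (\sum_j F j) i = \sum_j PhiE (F j) i.
Proof.
by apply: (big_morph (PhiE^~ i)) => [u v|]; [apply: PhiE_add | apply: PhiE_0].
Qed.

Lemma PhiE_scalar c u i : PhiE (act_scalar c u) i = c *: PhiE u i.
Proof. by rewrite /PhiE ffunE Phi_scale. Qed.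

Lemma PhiE_t u i : PhiE (act_t f u) i = tpow f 1 (PhiE u i).
Proof. by rewrite /PhiE ffunE Phi_t. Qed.

Lemma PhiE_dt u i : PhiE (act_dt u) i = dt f (rc (twist i)) (PhiE u i).
Proof. by rewrite /PhiE ffunE Phi_dt. Qed.

Lemma PhiE_iter_dt n u i :
  PhiE (iter n (@act_dt K l) u) i = iter n (dt f (rc (twist i))) (PhiE u i).
Proof. by elim: n => //= n IH; rewrite PhiE_dt IH. Qed.

Lemma PhiE_der xi u i : derivation_at iota x xi ->
  PhiE (act_der f beta xi u) i = ders xi f (PhiE u i).
Proof.
move=> hxi; rewrite /PhiE ffunE -rc_twist (Phi_der hxi) //.
exact: (der_const hxi).
Qed.

Lemma PhiE_euler g u i :
  PhiE (act_euler iota f g u) i = - (('X + (rc (g - twist i))%:P) * PhiE u i).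
Proof.
rewrite /act_euler -[- act_scalar _ _]scaleN1r PhiE_add PhiE_dt PhiE_t.
rewrite dt_tpow // [PhiE (_ *: _) i]/PhiE ffunE -/(PhiE _ i) Phi_scale.
rewrite -/(PhiE _ _) PhiE_scalar rmorphB polyCB /= -!mul_polyC; ring.
Qed.

Lemma PhiE_inj u v : (forall i, PhiE u i = PhiE v i) -> u = v.
Proof. by move=> h; apply/ffunP => i; apply: (Phi_inj f_neq0 (h i)). Qed.

Definition single i w : E := [ffun j => if j == i then w else 0].

Lemma graph_PhiE u : graph_module x f u -> forall i, pole_poly x f (PhiE u i).
Proof.
move=> hu i; rewrite /PhiE; have : pole_poly x f (u i) by exact: hu.
elim/poly_ind: (u i) => [_|w a IH].
  by rewrite linear0; exact: (pole_poly0 _ hx).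
move=> /(pole_poly_cons hx xf) [/IH hw ha]; rewrite Phi_cons.
apply: (pole_polyD hx xf); last exact: (pole_polyC hx).
exact: pole_poly_dt.
Qed.

Lemma graph_single i w : pole_poly x f w -> graph_module x f (single i w).
Proof.
move=> pw j k; rewrite ffunE; case: eqP => _; first exact: pw.
by rewrite coef0; apply: (poles0 _ hx).
Qed.

Lemma PhiE_single i w j :
  PhiE (single i w) j = if j == i then Phi f (rc (twist i)) w else 0.
Proof. by rewrite /PhiE ffunE; case: eqP => [->|_] //; rewrite linear0. Qed.

Lemma exists_PhiE (W : 'I_l -> {poly K}) : (forall i, pole_poly x f (W i)) ->
  exists u : E, graph_module x f u /\ forall i, PhiE u i = W i.
Proof.
move=> pW.
have /choice [U hU] := fun i => Phi_surj hx f_neq0 xf (twist i) (pW i).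
exists [ffun i => U i]; split=> [i j|i]; first by rewrite ffunE; apply: (hU i).1.
by rewrite /PhiE ffunE (hU i).2.
Qed.

(** Lets the results on D[s]-submodules be applied in one summand; there s is recovered as i beta -
    d_t t. *)
Lemma Ds_single (S : set E) i : V0D_submodule iota x f beta S ->
  Ds_submodule iota x f
    [set w | exists v : {poly K}, Phi f (rc (twist i)) v = w /\ S (single i v)].
Proof.
move=> [[S0 SD] SZ Sder St Sdt]; split.
- split=> [|_ _ [v [<- Sv]] [v' [<- Sv']]].
    exists 0; rewrite linear0; split=> //.
    by have -> : single i 0 = 0 by apply/ffunP => j; rewrite !ffunE; case: ifP.
  exists (v + v'); rewrite Phi_add; split=> //.
  have -> : single i (v + v') = single i v + single i v'.
    by apply/ffunP => j; rewrite !ffunE; case: ifP; rewrite ?addr0.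
  exact: SD.
- move=> a _ xa [v [<- Sv]]; exists (a *: v); rewrite Phi_scale; split=> //.
  have -> : single i (a *: v) = act_scalar a (single i v).
    by apply/ffunP => j; rewrite !ffunE; case: ifP; rewrite ?scaler0.
  exact: SZ.
- move=> _ [v [<- Sv]].
  exists (rc (twist i) *: v - 'X * (f *: v - v^`())); split.
    rewrite linearB /= Phi_dt Phi_t // dt_tpow // Phi_scale -mul_polyC; ring.
  have -> : single i (rc (twist i) *: v - 'X * (f *: v - v^`()))
     = act_scalar (rc (twist i)) (single i v)
       + act_scalar (- 1) (act_dt (act_t f (single i v))).
    apply/ffunP => j; rewrite !ffunE; case: ifP => _; rewrite ?scaleN1r //.
    by rewrite !scaler0 deriv0 subr0 mulr0 oppr0 addr0.
  apply: SD; first by apply: SZ => //; apply: loc_rc hx _.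
  by apply: SZ; [exact: (locN hx (loc1 hx))|apply: Sdt].
- move=> xi _ hxi [v [<- Sv]].
  exists (act_der f beta xi (single i v) i); split; last first.
    suff -> : single i (act_der f beta xi (single i v) i)
      = act_der f beta xi (single i v) by apply: Sder.
    apply/ffunP => j; rewrite ffunE; case: eqP => [->|/eqP ji] //.
    by rewrite !ffunE (negPf ji) map_poly0 mulr0 !scaler0 subr0 addr0.
  have := PhiE_der (single i v) i hxi; by rewrite PhiE_single eqxx.
Qed.

Context (bs : seq R).
Hypothesis hbs : Lat iota x f 1 (pol bs).

(** On the summand of y^i, d_t t - g acts as - (s + g - i beta); hence the shift of the index by
    [twist i]. *)
Definition Vfil g : set E := [set u | graph_module x f u /\
  forall i, VM iota x f (g - twist i) (PhiE u i)].

Lemma Vfil_bound g : exists N : nat, forall i h a, `|h - g| < 1 -> a \in bs ->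
  `|a| + `|h - twist i| < N%:R.
Proof.
have [B HB] := seq_bounded bs.
have [C HC] := seq_bounded [seq twist i | i <- enum 'I_l].
exists (Num.bound (`|B| + `|C| + `|g| + 1)) => i h a hg /HB aB.
have {}HC : `|twist i| <= C by apply/HC/map_f; rewrite mem_enum.
have h1 := ler_normB h (twist i).
have h2 : `|h| <= `|h - g| + `|g| by rewrite -{1}(subrK g h) ler_normD.
apply: le_lt_trans (archi_boundP _); last by rewrite !addr_ge0.
by have := ler_norm B; have := ler_norm C; lra.
Qed.

Lemma Vfil_isolated g : exists2 e : R, 0 < e <= 1 &
  forall i a (k : int) h, a \in bs -> `|h - g| < e ->
    a + k%:~R != g - twist i ->
    (g - twist i <= a + k%:~R) = (h - twist i <= a + k%:~R).
Proof.
have [e e0 He] := seq_isolated [seq a + twist i | a <- bs, i <- enum 'I_l] g.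
exists (Num.min e 1); first by rewrite lt_min e0 ltr01 ge_min lexx orbT.
move=> i a k h ab; rewrite lt_min => /andP[he _] ne.
have := He (a + twist i) k.
have am : a + twist i \in [seq a + twist i | a <- bs, i <- enum 'I_l].
  by apply/allpairsP; exists (a, i); rewrite mem_enum.
move=> /(_ am).
have -> : (a + twist i + k%:~R != g).
  by apply: contra ne => /eqP <-; apply/eqP; ring.
move=> /(_ isT) ed; rewrite !lerBlDr.
have {}ed : `|h - g| < `|a + twist i + k%:~R - g| by exact: lt_le_trans ed.
have [gle|glt] := leP g (a + k%:~R + twist i).
  apply/esym; move: ed; rewrite [X in _ < X]ger0_norm; last lra.
  by have := ler_norm (h - g) => h1 h2; lra.
apply/esym/negbTE; rewrite -ltNge; move: ed.
rewrite [X in _ < X]ltr0_norm; last lra.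
by have := ler_norm (- (h - g)); rewrite normrN => h1 h2; lra.
Qed.

Lemma PhiE_graph u : (forall i, pole_poly x f (PhiE u i)) -> graph_module x f u.
Proof.
move=> /exists_PhiE [v [gv vE]].
by have -> : u = v by apply: PhiE_inj => i; rewrite vE.
Qed.

Lemma VfilP g u : Vfil g u <-> forall i, VM iota x f (g - twist i) (PhiE u i).
Proof.
split=> [[]//|h]; split=> //; apply: PhiE_graph => i.
exact: (VM_pole_poly hx f_neq0 xf (h i)).
Qed.

Let VMDs h := VM_Ds hx f_neq0 xf h.

Lemma Vfil_le g h u : g <= h -> Vfil h u -> Vfil g u.
Proof.
move=> gh /VfilP H; apply/VfilP => i; apply: VM_le (H i); by rewrite lerD2r.
Qed.

Lemma Vfil_t g u : Vfil g u -> Vfil (g + 1) (act_t f u).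
Proof.
move=> /VfilP H; apply/VfilP => i; rewrite PhiE_t addrAC.
by have := VM_tpow f_neq0 1 (H i); rewrite mulr1z.
Qed.

Lemma Vfil_dt g u : Vfil g u -> Vfil (g - 1) (act_dt u).
Proof.
move=> /VfilP H; apply/VfilP => i; rewrite PhiE_dt addrAC.
exact: (VM_dt hx f_neq0 xf _ (H i)).
Qed.

Lemma Vfil_V0D g : V0D_submodule iota x f beta (Vfil g).
Proof.
split.
- split=> [|u v /VfilP hu /VfilP hv]; apply/VfilP => i.
    by rewrite PhiE_0; apply: (Ds0 (VMDs _)).
  by rewrite PhiE_add; apply: (DsD (VMDs _)).
- move=> a u xa /VfilP hu; apply/VfilP => i.
  by rewrite PhiE_scalar; apply: (DsZ (VMDs _)).
- move=> xi u hxi /VfilP hu; apply/VfilP => i.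
  by rewrite PhiE_der //; apply: (Ds_der (VMDs _)).
- by move=> u /Vfil_t; apply: Vfil_le; rewrite lerDl.
- by move=> u /Vfil_t /Vfil_dt; rewrite addrK.
Qed.

Lemma sum_single u : u = \sum_i single i (u i).
Proof.
apply/ffunP => j; rewrite sum_ffunE (bigD1 j) //= ffunE eqxx big1 ?addr0 // => i.
by move=> /negPf ij; rewrite ffunE eq_sym ij.
Qed.

(** Two generators suffice in each summand: t^N f^s, and t^-N f^s multiplied by the product F' of
    the factors of [Tot] with index below the bound. For w in the filtration step, the complementary
    product F carries w into the part generated by the first, F' carries it into the part generated
    by the second, and Bezout gives w. *)
Lemma Vfil_generated g :
  exists s : seq E, Vfil g = smallest (V0D_submodule iota x f beta) [set` s].
Proof.
have [N HN] := Vfil_bound g.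
have {}HN i a : a \in bs -> `|a| + `|g - twist i| < N%:R.
  by apply: HN; rewrite subrr normr0.
pose F i := filter (>= (g - twist i)) (Tot bs (- N%:Z) (N + N)).
pose F' i := filter (predC (>= (g - twist i))) (Tot bs (- N%:Z) (N + N)).
have LN n : Lat iota x f n (tpow f n 1) by apply/Lat0_tpow => //; apply: Lat01.
have pp n : pole_poly x f (tpow f n 1).
  exact: (Lat_pole_poly hx f_neq0 xf (LN n)).
have /choice [v1 h1] := fun i => Phi_surj hx f_neq0 xf (twist i) (pp N%:Z).
have /choice [v2 h2] := fun i => Phi_surj hx f_neq0 xf (twist i)
  (Lat_pole_poly hx f_neq0 xf
    (Ds_pol hx (Lat_Ds hx f_neq0 (- N%:Z)) (F' i) (LN (- N%:Z)))).
exists ([seq single i (v1 i) | i <- enum 'I_l]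
     ++ [seq single i (v2 i) | i <- enum 'I_l]).
apply/seteqP; split=> u.
  move=> /VfilP hu S [DS GS]; rewrite (sum_single u).
  have {}DS' i := Ds_single i DS; case: (DS) => [[S0 SD] _ _ _ _].
  elim/big_ind: _ => // i _.
  pose W i := [set w | exists v : {poly K},
    Phi f (rc (twist i)) v = w /\ S (single i v)].
  have W1 : W i (tpow f N%:Z 1).
    exists (v1 i); split; first exact: (h1 i).2.
    apply: GS; rewrite /= mem_cat; apply/orP; left.
    by apply/mapP; exists i; rewrite ?mem_enum.
  have W2 : W i (pol (F' i) * tpow f (- N%:Z) 1).
    exists (v2 i); split; first exact: (h2 i).2.
    apply: GS; rewrite /= mem_cat; apply/orP; right.
    by apply/mapP; exists i; rewrite ?mem_enum.
  have /(VM_char hx f_neq0 xf hbs _ (HN i)) [L1 L2] := hu i.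
  have : W i (PhiE u i).
    apply: (Ds_coprime hx (DS' i) (s := F i) (s' := F' i)).
    - by move=> a; rewrite !mem_filter => /andP[/= ->].
    - exact: (Lat_sub hx f_neq0 (DS' i) W1).
    - have D := Ds_preimage hx (Ds_op_pol iota x f (F' i)) (DS' i).
      exact: (Lat_sub hx f_neq0 D W2 L1).
  by move=> [v [/(Phi_inj f_neq0) -> ]].
apply: smallest_sub; first exact: Vfil_V0D.
move=> v /=; rewrite mem_cat => /orP[] /mapP[i _ ->]; apply/VfilP => j;
  rewrite PhiE_single; case: eqP => [->|_]; try exact: (Ds0 (VMDs _)).
  rewrite (h1 i).2; apply: (VM_Lat hx f_neq0 xf hbs) (LN N%:Z) => a /(HN i).
  have := ler_norm (- a); have := ler_norm (g - twist i); rewrite normrN.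
  rewrite -pmulrn; lra.
rewrite (h2 i).2; apply/(VM_char hx f_neq0 xf hbs _ (HN i)); split.
  by apply: (Ds_pol hx (Lat_Ds hx f_neq0 _)).
rewrite mulrA -pol_filter.
have := Lat_Tot hx f_neq0 hbs (N + N) (LN (- N%:Z)).
by have -> : - N%:Z + (N + N)%N%:Z = N%:Z by lia.
Qed.

Lemma PhiE_iter_euler n g u i : PhiE (iter n (act_euler iota f g) u) i
  = (-1) ^+ n *: (pol (nseq n (g - twist i)) * PhiE u i).
Proof.
elim: n => [|n IH] /=; first by rewrite pol_nil mul1r scale1r.
rewrite PhiE_euler IH pol_cons exprS mulN1r -!mul_polyC polyCN; ring.
Qed.

Lemma Vfil_is_V_filtration : is_V_filtration iota x f beta Vfil.
Proof.
split.
- by move=> g; split; [move=> u [] | exact: Vfil_generated].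
- split=> [g h gh u|u gu]; first exact: Vfil_le.
  have /choice [G HG] := fun i =>
    VM_exhaustive hx f_neq0 xf hbs (graph_PhiE gu i).
  have [B HB] := seq_bounded [seq G i + twist i | i <- enum 'I_l].
  exists (- B); apply/VfilP => i; apply: VM_le (HG i).
  have /HB : G i + twist i \in [seq G i + twist i | i <- enum 'I_l].
    by apply/mapP; exists i; rewrite ?mem_enum.
  by have := ler_norm (- (G i + twist i)); rewrite normrN; lra.
- move=> g; have [e /andP[e0 e1] He] := Vfil_isolated g.
  have [N HN] := Vfil_bound g.
  have key h h' : `|h - g| < e -> `|h' - g| < e -> (h <= g) = (h' <= g) ->
      Vfil h = Vfil h'.
    move=> he h'e hh'; apply/seteqP.
    have P i w : VM iota x f (h - twist i) w <-> VM iota x f (h' - twist i) w.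
      apply: (VM_eq hx f_neq0 xf hbs (N := N)).
      - by move=> a ab; apply: HN => //; apply: lt_le_trans he e1.
      - by move=> a ab; apply: HN => //; apply: lt_le_trans h'e e1.
      move=> a k ab; have [E|ne] := eqVneq (a + k%:~R) (g - twist i).
        by rewrite E !lerD2r.
      by rewrite -(He i a k h) // -(He i a k h').
    by split=> u /VfilP H; apply/VfilP => i; apply/P.
  exists e => //; split=> [h /andP[eh hg]|h h' /andP[gh hge] /andP[gh' hge']].
    by apply: key; rewrite ?subrr ?normr0 ?lexx ?hg // ler0_norm; lra.
  apply: key.
  - by rewrite gtr0_norm; lra.
  - by rewrite gtr0_norm; lra.
  - by rewrite !leNgt gh gh'.
- split=> [g u||g u]; [exact: Vfil_t| |exact: Vfil_dt].
  (* As t is invertible on O_X( *Z)[s] f^s, V^(g + 1) = t V^g holds from any index on. *)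
  exists 0 => g _; apply/seteqP; split=> [u /VfilP hu|_ [u hu <-]]; last first.
    exact: Vfil_t.
  have hv i : VM iota x f (g - twist i) (tpow f (-1) (PhiE u i)).
    have := VM_tpow f_neq0 (-1) (hu i).
    by rewrite rmorphN1 addrAC addrK.
  have [v [_ vE]] := exists_PhiE (fun i => VM_pole_poly hx f_neq0 xf (hv i)).
  exists v; first by apply/VfilP => i; rewrite vE.
  by apply: PhiE_inj => i; rewrite PhiE_t vE (tpowNK f_neq0 1).
- move=> g; have [e /andP[e0 e1] He] := Vfil_isolated g.
  have [N HN] := Vfil_bound g.
  (* One exponent must serve all summands; the sum bounds each of the indices. *)
  exists (\sum_i nilp_index bs N (g - twist i)) => u /VfilP hu.
  (* An index past g, but before the next possible jump. *)
  have hh : `|g + e / 2 - g| < e by rewrite addrC addKr gtr0_norm; lra.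
  exists (g + e / 2); first lra.
  apply/VfilP => i; rewrite PhiE_iter_euler.
  apply: (DsZ (VMDs _)); first exact: (locX hx _ (locN hx (loc1 hx))).
  apply: (VM_nilpotent hx f_neq0 xf hbs (N := N)) (hu i).
  - by move=> a ab; apply: HN; rewrite ?subrr ?normr0.
  - by move=> a ab; apply: HN => //; apply: lt_le_trans hh e1.
  - lra.
  - by move=> a k ab ne; apply: He.
  - by rewrite (bigD1 i) //= leq_addr.
Qed.

End GraphModule.

(** * From the roots to the Hodge ideal *)

Section Jacobian.
Context {R : realType} {K : fieldType} (iota : {rmorphism R[i] -> K}).
Context (x : set K) (f : K).
Hypothesis hx : subalgebra iota x.
Hypothesis f_neq0 : f != 0.
Hypothesis xf : x f.
Local Notation rc := (rc iota).
Local Notation pol := (pol iota).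
Local Notation Ds := (Ds_submodule iota x f).
Local Notation sDs := (smallest Ds).
Implicit Types (u v w y : {poly K}) (g h a : R) (s : seq R).

Definition jacobian : set {poly K} := [set w | w = f%:P \/
  exists xi, derivation_at iota x xi /\ w = (xi f)%:P].

(** Such sums are stable under D[s]: s c f = (s + 1) c f - c f, and xi (c f f^s) = (xi(c) f + (s +
    1) c xi(f)) f^s. *)
Lemma Lat1_decomposition w : Lat iota x f 1 w ->
  exists y c, [/\ sDs jacobian y, x c & w = ('X + 1) * y + (c * f)%:P].
Proof.
have DJ : Ds (sDs jacobian) by apply: sDs_Ds.
have Jf : sDs jacobian f%:P by apply: sub_gen_smallest; left.
apply: (Lat_sub hx f_neq0 (N := [set w | exists y c,
  [/\ sDs jacobian y, x c & w = ('X + 1) * y + (c * f)%:P]])); last first.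
  exists 0, 1; split; [exact: (Ds0 DJ)|exact: (loc1 hx)|].
  by rewrite mulr0 add0r mul1r (tpowC f 1 1) mulr1.
split.
- split=> [|_ _ [y [c [Jy xc ->]]] [y' [c' [Jy' xc' ->]]]].
    exists 0, 0; split; [exact: (Ds0 DJ)|exact: (loc0 hx)|].
    by rewrite mulr0 mul0r addr0.
  exists (y + y'), (c + c'); split; [exact: (DsD DJ)|exact: (locD hx)|].
  by rewrite !polyCM polyCD; ring.
- move=> a _ xa [y [c [Jy xc ->]]].
  exists (a *: y), (a * c); split; [exact: (DsZ DJ)|exact: (locM hx)|].
  by rewrite -!mul_polyC !polyCM; ring.
- move=> _ [y [c [Jy xc ->]]].
  exists ('X * y + c *: f%:P), (- c); split; [|exact: (locN hx)|].
    by apply: (DsD DJ); [exact: (DsX DJ)|exact: (DsZ DJ)].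
  by rewrite -!mul_polyC !polyCM polyCN; ring.
- move=> xi _ hxi [y [c [Jy xc ->]]].
  exists (ders xi f y + c *: (xi f)%:P), (xi c); split.
  + apply: (DsD DJ); first exact: (Ds_der DJ).
    by apply: (DsZ DJ) => //; apply: sub_gen_smallest; right; exists xi.
  + by case: hxi => _ _ _; apply.
  rewrite -[_ + _]/(ders xi f _) (dersD hxi) (dersMl hxi); last first.
    by rewrite (mapdD hxi) (mapdX hxi) (mapdC hxi 1) (der1 hxi) addr0.
  rewrite (dersC hxi) (derM hxi).
  have -> : c * f * (xi f / f) = c * xi f by field.
  by rewrite -!mul_polyC !(polyCD, polyCM); ring.
Qed.

Lemma Lat1_horner w : Lat iota x f 1 w -> exists2 c, x c & w.[- 1] = c * f.
Proof.
move=> /Lat1_decomposition [y [c [_ xc ->]]]; exists c => //.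
by rewrite hornerD hornerM hornerD hornerX hornerC (hornerC 1) addNr mul0r add0r.
Qed.

(* The reduced Bernstein-Sato polynomial is the minimal polynomial of s on
   D[s] f^s / D[s] (f, J_f) f^s. *)
Lemma Lat1_reduced w : Lat iota x f 1 (('X + 1) * w) <-> sDs jacobian w.
Proof.
split=> [L|Jw].
  have [y [c [Jy xc e]]] := Lat1_decomposition L.
  have cf0 : c * f = 0.
    have := congr1 (horner^~ (- 1)) e; rewrite !hornerE.
    by rewrite addNr !mul0r add0r.
  move: e; rewrite cf0 polyC0 addr0 => /mulfI -> //.
  by rewrite -size_poly_eq0 size_XaddC.
have DL := Lat_Ds hx f_neq0 1.
have D : Ds_op iota x f ( *%R ('X + 1)).
  by have := Ds_op_pol iota x f [:: 1]; rewrite pol_cons pol_nil mulr1 rmorph1.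
have Lf : Lat iota x f 1 f%:P by apply: Lat1f.
move: w Jw; apply: (Ds_op_sub hx D DL) => _ [->|[xi [hxi ->]]].
  have := DsXh hx DL 1 Lf; by rewrite rmorph1.
have -> : ('X + 1) * (xi f)%:P = ders xi f f%:P.
  rewrite (dersC hxi) -!mul_polyC; have -> : f * (xi f / f) = xi f by field.
  by rewrite mulrDl mul1r addrC mulrC.
exact: (Ds_der DL).
Qed.

Lemma iter_dtX j c w :
  iter j (dt f c) ('X * w) = ('X - j%:R%:P) * iter j (dt f c) w.
Proof.
elim: j => [|j IH] /=; first by rewrite subr0.
by rewrite IH mulrBl linearB /= dtX mul_polyC dt_scale -mul_polyC -natr1 polyCD; ring.
Qed.

Lemma iter_dt_pol j c s w : iter j (dt f c) (pol s * w)
  = pol [seq h - j%:R | h <- s] * iter j (dt f c) w.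
Proof.
elim: s => [|h s IH]; first by rewrite pol_nil !mul1r.
rewrite /= !pol_cons -!mulrA -IH [in LHS]mulrDl iter_dt_add iter_dtX.
rewrite mul_polyC iter_dt_scale -mul_polyC rmorphB rmorph_nat polyCB; ring.
Qed.

Lemma scale_iter_dt1 j : f *: iter j.+1 (dt f (rc 0)) 1
  = - (('X - j%:R%:P) * iter j (dt f (rc 0)) 1).
Proof.
rewrite -iter_dt_scale alg_polyC iterSr dtC rmorph0 subr0 mulVf // scale1r.
by rewrite -scaleN1r iter_dt_scale scaleN1r -[X in iter j _ X]mulr1 iter_dtX.
Qed.

(** On generators: d_t^(j+1) sends f f^s to - (s - j) d_t^j f^s and, as d_t (xi(f) f^s) = - xi f^s,
    it sends xi(f) f^s to - xi d_t^j f^s. *)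
Lemma iter_dt_jacobian j y : sDs jacobian y ->
  sDs [set iter j (dt f (rc 0)) 1] (iter j.+1 (dt f (rc 0)) y).
Proof.
set T := sDs [set _]; have DT : Ds T by apply: sDs_Ds.
have T1 : T (iter j (dt f (rc 0)) 1).
  exact: sub_gen_smallest.
move: y; apply: (Ds_op_sub hx (Ds_op_iter_dt iota x f_neq0 0 j.+1) DT) => w.
have dtC0 (a : K) : dt f (rc 0) a%:P = - ((f^-1 * a) *: 'X).
  by rewrite dtC rmorph0 subr0.
case=> [->|[xi [hxi ->]]]; last rewrite iterSr dtC0.
  rewrite -[f%:P]mulr1 mul_polyC iter_dt_scale scale_iter_dt1.
  apply: (DsN hx DT); have := DsXh hx DT (- j%:R) T1.
  by rewrite rmorphN rmorph_nat polyCN.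
have -> : (f^-1 * xi f) *: 'X = ders xi f 1.
  by rewrite (dersC hxi _ 1) (der1 hxi) add0r mul1r mulrC.
rewrite -scaleN1r iter_dt_scale scaleN1r; apply: (DsN hx DT).
rewrite -(ders_iter_dt hxi) //; first exact: (Ds_der DT).
by rewrite rmorph0 (der0 hxi).
Qed.

(** * Membership of f^-(p+1) in the Hodge filtration *)

Section Sufficiency.
Context (cs : seq R) (hcs : Lat iota x f 1 (pol (1 :: cs))).
Context (alpha : rat) (halpha : 0 < alpha <= 1) (p : nat).
Local Notation al := (@ratr R alpha).
Hypothesis cs_ge : all (>= (al + p%:R)) cs.

Let al_gt0 : 0 < al. Proof. by rewrite ltr0q; case/andP: halpha. Qed.
Let al_le1 : al <= 1.
Proof. by rewrite -(ler_rat R) rmorph1 in (halpha); case/andP: halpha. Qed.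

Lemma iter_dt_VM j : (j <= p)%N -> VM iota x f al (iter j (dt f (rc 0)) 1).
Proof.
elim: j => [_|j IH jp].
  apply: (VM_Lat hx f_neq0 xf hcs (m := 0)); last exact: Lat01.
  (* The factor s + 1 is harmless because alpha <= 1. *)
  move=> h; rewrite addr0 inE => /orP[/eqP -> //|/(allP cs_ge) /=].
  by have := ler0n R p; lra.
have Jcs : sDs jacobian (pol cs).
  by apply/Lat1_reduced; move: hcs; rewrite pol_cons rmorph1.
have := iter_dt_jacobian (j := j) Jcs; rewrite -[pol cs]mulr1 iter_dt_pol => H.
have L1 := Lat_iter_dt hx f_neq0 0 j.+1 (@Lat01 R K iota x f).
apply: (VM_pol _ L1 (s := [seq h - j.+1%:R | h <- cs])).
  apply/allP => _ /mapP[h /(allP cs_ge) /= hh ->].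
  by move: jp; rewrite -(ler_nat R); lra.
have DV := VM_Ds hx f_neq0 xf al.
apply: (sDs_sub DV _ H) => _ ->; exact: IH (ltnW jp).
Qed.

Local Notation be := (rc (1 - al)).

(* The part of degree n of the Hodge filtration on the summand of y, in the
   s-encoding, where V^0 has become VM (alpha - 1). *)
Definition FM n w := exists v : nat -> {poly K},
  (forall i, (i <= n)%N -> VM iota x f (al - 1) (v i) /\ (size (v i) <= (n - i).+1)%N)
  /\ w = \sum_(i < n.+1) iter i (dt f be) (v i).

Lemma FM_add n w w' : FM n w -> FM n w' -> FM n (w + w').
Proof.
move=> [v [hv ->]] [v' [hv' ->]]; exists (fun i => v i + v' i); split.
  move=> i le_in; have [V1 s1] := hv i le_in; have [V2 s2] := hv' i le_in.
  split; first exact: (DsD (VM_Ds hx f_neq0 xf _)).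
  by rewrite (leq_trans (size_polyD _ _)) // geq_max s1.
by rewrite -big_split /=; apply: eq_bigr => i _; rewrite iter_dt_add.
Qed.

Lemma FM_scale n (a : K) w : x a -> FM n w -> FM n (a *: w).
Proof.
move=> xa [v [hv ->]]; exists (fun i => a *: v i); split.
  move=> i /hv [V1 s1]; split; first exact: (DsZ (VM_Ds hx f_neq0 xf _)).
  exact: leq_trans (size_scale_leq _ _) s1.
by rewrite scaler_sumr; apply: eq_bigr => i _; rewrite iter_dt_scale.
Qed.

Lemma FM_dt n w : FM n w -> FM n.+1 (dt f be w).
Proof.
move=> [v [hv ->]]; exists (fun i => if i is j.+1 then v j else 0); split.
  case=> [|i]; last by rewrite ltnS => /hv.
  by split; [apply: (Ds0 (VM_Ds hx f_neq0 xf _))|rewrite size_poly0].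
by rewrite [RHS]big_ord_recl add0r linear_sum.
Qed.

Lemma FM_base j : (j <= p)%N -> FM j (tpow f (- 1) (iter j (dt f (rc 0)) 1)).
Proof.
move=> jp; exists (fun i => if i is 0%N then tpow f (- 1) (iter j (dt f (rc 0)) 1)
  else 0); split; last first.
  by rewrite big_ord_recl big1 ?addr0 // => i _; rewrite linear0.
case=> [|i] _; last by split; [apply: (Ds0 (VM_Ds hx f_neq0 xf _))|rewrite size_poly0].
split; last by rewrite size_tpow // size_iter_dt ?oner_neq0 // size_poly1 subn0.
by have := VM_tpow f_neq0 (-1) (iter_dt_VM jp); rewrite rmorphN1.
Qed.

(** Induction on n. A factor t^-1 is traded either for an outer twisted d_t or for one more inner
    d_t, until t^-1 d_t^j f^s with j <= p is reached, which is [FM_base]. *)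
Lemma FM_tpow n j : (n + j <= p)%N ->
  FM (n + j) (tpow f (- n.+1%:Z) (iter j (dt f (rc 0)) 1)).
Proof.
elim: n j => [|n IH] j njp; first exact: FM_base.
(* The scalar to be inverted below; it is nonzero because alpha > 0. *)
have ne0 : - al - n%:R != 0.
  by rewrite -opprD oppr_eq0 gt_eqF // ltr_wpDr ?ler0n.
set w := iter j _ 1.
(* [d_t, t^(-a)] measures the twist: this is where the coefficients come from. *)
have -> : tpow f (- n.+2%:Z) w = rc (- al - n%:R)^-1 *:
   (dt f be (tpow f (- n.+1%:Z) w)
    + rc (- 1) *: tpow f (- n.+1%:Z) (dt f (rc 0) w)).
  have -> : dt f be (tpow f (- n.+1%:Z) w) = - (('X - be%:P) * tpow f (- n.+2%:Z) w).
    by rewrite /dt tpowD //; congr (- (_ * tpow f _ _)); lia.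
  have -> : tpow f (- n.+1%:Z) (dt f (rc 0) w)
      = - (('X - n.+1%:R%:P) * tpow f (- n.+2%:Z) w).
    rewrite /dt rmorph0 subr0 -mulNr tpowM tpowD // rmorphN /= comp_polyX mulNr.
    by rewrite mulrNz polyCN; congr (- (_ * tpow f _ _)); lia.
  have subE (A B t : {poly K}) : - (A * t) + rc (- 1) *: - (B * t) = (B - A) * t.
    by rewrite rmorphN1 scaleN1r; ring.
  rewrite subE.
  have -> : ('X - n.+1%:R%:P) - ('X - be%:P) = (rc (- al - n%:R))%:P.
    rewrite !rmorphB rmorphN rmorph1 /= -natr1 !(polyCN, polyCB, polyCD).
    rewrite rmorph_nat; ring.
  by rewrite mul_polyC scalerA -rmorphM mulVf // rmorph1 scale1r.
apply: FM_scale; first exact: (loc_rc hx).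
apply: FM_add.
  by rewrite addSn; apply: FM_dt; apply: IH; apply: ltnW.
apply: FM_scale; first exact: (loc_rc hx).
by rewrite addSnnS; apply: (IH j.+1); rewrite -addSnnS.
Qed.

Lemma F_M_of_roots l (hl : (1 < l)%N) (g : K) : x g ->
  F_M iota x f l (1 - alpha) p (g / f ^+ p.+1).
Proof.
move=> xg; pose i1 : 'I_l := Ordinal hl.
have tw : twist (1 - alpha) i1 = 1 - al :> R.
  by rewrite /twist mul1r rmorphB rmorph1.
have [v [hv vE]] : FM p (g / f ^+ p.+1)%:P.
  (* The case n = p, j = 0, where t^-(p+1) applied to f^s has coefficient f^-(p+1). *)
  have := FM_scale xg (@FM_tpow p 0 _); rewrite addn0 => /(_ (leqnn _)) /=.
  by rewrite (tpowC f _ 1) mulr1 -mul_polyC -polyCM -exprnN.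
have hv' (i : 'I_p.+1) : exists u : {poly K},
    pole_poly x f u /\ Phi f (rc (twist (1 - alpha) i1)) u = v i.
  apply: Phi_surj => //; have [|V1 _] := hv i; first by rewrite -ltnS.
  exact: (VM_pole_poly hx f_neq0 xf V1).
have [u hu] := choice hv'.
exists (fun i => single i1 (u i)); split=> [i|].
  have [|V1 s1] := hv i; first by rewrite -ltnS.
  split.
    exists (Vfil iota x f (1 - alpha) (l := l)).
      exact: Vfil_is_V_filtration hcs.
    apply/VfilP => // j; rewrite PhiE_single; case: eqP => [->|_].
      (* On the summand of y, V^0 has index 0 - (1 - alpha) = alpha - 1. *)
      by rewrite (hu i).2 tw sub0r opprB.
    exact: (Ds0 (VM_Ds hx f_neq0 xf _)).
  split; first exact: (graph_single hx i1 (hu i).1).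
  move=> j; rewrite ffunE; case: eqP => _; last by rewrite size_poly0.
  by rewrite -(size_Phi f_neq0 (rc (twist (1 - alpha) i1))) (hu i).2.
apply: (PhiE_inj f_neq0 (iota := iota) (beta := 1 - alpha)) => j.
rewrite PhiE_sum.
under eq_bigr do rewrite PhiE_iter_dt PhiE_single.
have -> : y_delta l (g / f ^+ p.+1) = single i1 (g / f ^+ p.+1)%:P by [].
rewrite PhiE_single; case: eqP => [->|_].
  rewrite PhiC vE; apply: eq_bigr => i _; by rewrite (hu i).2 tw.
by rewrite big1 // => i _; rewrite linear0.
Qed.

End Sufficiency.
End Jacobian.

(** * From the Hodge ideal to the roots *)

Section Necessity.
Context {R : realType} {K : fieldType} (iota : {rmorphism R[i] -> K}).
Context (x : set K) (f : K).
Hypothesis hx : subalgebra iota x.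
Hypothesis f_neq0 : f != 0.
Hypothesis xf : x f.
Local Notation rc := (rc iota).
Local Notation pol := (pol iota).
Local Notation Lat := (Lat iota x f).
Local Notation Ds := (Ds_submodule iota x f).
Local Notation sDs := (smallest Ds).
Local Notation J := (sDs (jacobian iota x f)).
Implicit Types (g h : R) (s : seq R).

(** * Consequences of the axioms of a V-filtration *)

Section AnyVFiltration.
Context (l : nat) (beta : rat).
Local Notation E := {ffun 'I_l -> {poly K}}.
Context (V : R -> set E) (hV : is_V_filtration iota x f beta V).
Implicit Types (u v : E) (i : 'I_l).
Local Notation PhiE := (PhiE iota f beta).

(** Membership in [V_filtration] yields some V, known only through the axioms. Nilpotency of d_t t -
    g moves an element of V^g to a strictly larger index, at the cost of factors with g >= 0.
    Left-continuity of V at the supremum of the indices reached shows that they are unbounded. *)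
Lemma V_push v i : V 0 v -> forall H, exists s u n,
  [/\ all (>= 0) s, V H u
    & PhiE u i = (-1) ^+ n *: (pol [seq h - twist beta i | h <- s] * PhiE v i)].
Proof.
move=> Vv H.
pose Q g := exists s u n, [/\ all (>= 0) s, V g u
  & PhiE u i = (-1) ^+ n *: (pol [seq h - twist beta i | h <- s] * PhiE v i)].
pose A := [set g | 0 <= g /\ Q g].
have [_ [Vle _] Vjump _ Vnil] := hV.
have A0 : A 0.
  by split=> //; exists [::], v, 0%N; split; rewrite // pol_nil mul1r scale1r.
have stepA g : A g -> exists2 h, g < h & A h.
  move=> [g0 [s [u [n [hs Vu Eu]]]]]; have [m Hm] := Vnil g.
  have [h gh Vh] := Hm u Vu; exists h => //.
  split; first exact: ltW (le_lt_trans g0 gh).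
  exists (nseq m g ++ s), (iter m (act_euler iota f g) u), (m + n)%N.
  split=> //; first by rewrite all_cat hs andbT; apply/allP => a /nseqP[-> _].
  rewrite (PhiE_iter_euler _ f_neq0) Eu map_cat map_nseq pol_cat exprD -!mul_polyC.
  rewrite polyCM; ring.
suff [h [hA Hh]] : exists h, A h /\ H <= h.
  case: hA => _ [s [u [n [hs Vu Eu]]]]; exists s, u, n; split=> //.
  exact: Vle Vu.
apply: contrapT => noA.
have ubA : ubound A H.
  by move=> h Ah; rewrite leNgt; apply/negP => Hh; apply: noA; exists h; rewrite ltW.
have supA : has_sup A by split; [exists 0|exists H].
have [e e0 [He _]] := Vjump (sup A).
have [h Ah hlt] := sup_adherent e0 supA.
have hle := sup_upper_bound supA Ah.
have AG : A (sup A).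
  case: Ah => h0 [s [u [n [hs Vu Eu]]]]; split; first exact: le_trans hle.
  by exists s, u, n; split=> //; rewrite -(He h) ?hlt.
have [h' Gh' Ah'] := stepA _ AG.
by have := sup_upper_bound supA Ah'; rewrite leNgt Gh'.
Qed.

Lemma V0D_Lat c i : V0D_submodule iota x f beta [set u : E | Lat c (PhiE u i)].
Proof.
have DL := Lat_Ds hx f_neq0 c (iota := iota).
have tL w : Lat c w -> Lat (c + 1) (tpow f 1 w) by move=> ?; apply/Lat_tpow.
split.
- split=> [|u v Lu Lv]; rewrite /= ?PhiE_0; first exact: (Ds0 DL).
  by rewrite PhiE_add; apply: (DsD DL).
- by move=> a u xa Lu; rewrite /= PhiE_scalar; apply: (DsZ DL).
- by move=> xi u hxi Lu; rewrite /= (PhiE_der f_neq0 _ _ _ hxi); apply: (Ds_der DL).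
- move=> u /tL Lu; rewrite /= PhiE_t //.
  exact: (Lat_succ hx f_neq0 xf Lu).
- move=> u /tL Lu; rewrite /= PhiE_dt PhiE_t // -[c](addrK 1).
  exact: (Lat_dt hx f_neq0).
Qed.

(** V^g0 is finitely generated, so its component at i lies in some t^c L; since V^(g0 + n) = t^n
    V^g0, that of V^(g0 + n) lies in t^(c + n) L, and n = |c| is enough. *)
Lemma V_Lat i : exists g, forall u, V g u -> Lat 0 (PhiE u i).
Proof.
have [Vfg _ _ [_ [g0 Vt] _] _] := hV.
have [Vgr [s Vs]] := Vfg g0.
have [c Hc] : exists c : int, forall u, u \in s -> Lat c (PhiE u i).
  have : forall u, u \in s -> graph_module x f u.
    move=> u us; apply: Vgr; rewrite Vs.
    by move=> N [_]; apply.
  elim: s {Vs} => [|u s IH] gs; first by exists 0.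
  have [c Hc] := IH (fun v vs => gs v (mem_behead (s := u :: s) vs)).
  have /(pole_poly_Lat hx f_neq0 xf) [d Ld] :=
    graph_PhiE hx f_neq0 xf beta (gs u (mem_head _ _)) i.
  exists (Num.min c d) => v; rewrite inE => /orP[/eqP ->|/Hc Lv].
    by apply: (Lat_le hx f_neq0 xf) Ld; rewrite ge_min lexx orbT.
  by apply: (Lat_le hx f_neq0 xf) Lv; rewrite ge_min lexx.
have H n u : V (g0 + n%:R) u -> Lat (c + n%:Z) (PhiE u i).
  elim: n u => [|n IH] u.
    rewrite !addr0 Vs; move: u; apply: smallest_sub; first exact: V0D_Lat.
    by move=> u /Hc.
  rewrite -natr1 addrA Vt ?lerDl ?ler0n // => -[v /IH Lv <-].
  rewrite PhiE_t //; rewrite -addn1 PoszD addrA.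
  exact/Lat_tpow.
exists (g0 + `|c|%N%:R) => u /H; apply: (Lat_le hx f_neq0 xf); lia.
Qed.

End AnyVFiltration.

(** * The graph direct image of O_X *)

Definition loc_poly (q : {poly K}) := forall j, x q`_j.

Lemma loc_poly_s q : loc_poly q -> loc_poly (- ('X * (f *: q - q^`()))).
Proof.
move=> hq j; rewrite coefN coefXM; apply: (locN hx).
case: eqP => _; first exact: (loc0 hx).
rewrite coefB coefZ coef_deriv -mulr_natr; apply: (locB hx).
  exact: (locM hx).
by apply: (locM hx) => //; apply: (loc_nat hx).
Qed.

Lemma Phi_s (q : {poly K}) :
  Phi f (rc 0) (- ('X * (f *: q - q^`()))) = 'X * Phi f (rc 0) q.
Proof.
rewrite -scaleN1r Phi_scale Phi_dt Phi_t // dt_tpow // rmorph0 subr0.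
by rewrite scaleN1r opprK.
Qed.

Lemma loc_poly_der xi q : derivation_at iota x xi -> loc_poly q ->
  loc_poly (mapd xi q - xi f *: ('X * q)).
Proof.
move=> hxi hq j; rewrite coefB coefZ coefXM (coef_mapd hxi).
have xix a : x a -> x (xi a) by case: hxi => _ _ _; apply.
apply: (locB hx); first exact: xix.
apply: (locM hx); first exact: xix.
by case: eqP => _; [exact: (loc0 hx)|].
Qed.

Lemma Phi_der0 xi (q : {poly K}) : derivation_at iota x xi ->
  Phi f (rc 0) (mapd xi q - xi f *: ('X * q)) = ders xi f (Phi f (rc 0) q).
Proof.
move=> hxi; rewrite -(Phi_der hxi f_neq0).
  by rewrite (rmorph0 rc) mul0r scale0r addr0.
by rewrite rmorph0 (der0 hxi).
Qed.

(** The sum of the O_X d_t^j f^s, inside the graph direct image of O_X( *Z). *)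
Definition graph_stalk : set {poly K} :=
  [set w | exists q, loc_poly q /\ Phi f (rc 0) q = w].

Lemma graph_stalk_Ds : Ds graph_stalk.
Proof.
split.
- split=> [|_ _ [q [hq <-]] [q' [hq' <-]]].
    exists 0; rewrite linear0; split=> // j; rewrite coef0; exact: (loc0 hx).
  exists (q + q'); rewrite Phi_add; split=> // j; rewrite coefD.
  exact: (locD hx).
- move=> a _ xa [q [hq <-]]; exists (a *: q); rewrite Phi_scale; split=> // j.
  by rewrite coefZ; apply: (locM hx).
- move=> _ [q [hq <-]]; exists (- ('X * (f *: q - q^`()))).
  by split; [exact: loc_poly_s|exact: Phi_s].
- move=> xi _ hxi [q [hq <-]]; exists (mapd xi q - xi f *: ('X * q)).
  by split; [exact: loc_poly_der|exact: Phi_der0].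
Qed.

Lemma Lat0_graph_stalk w : Lat 0 w -> graph_stalk w.
Proof.
apply: (Lat_sub hx f_neq0 graph_stalk_Ds); rewrite tpow0; exists 1.
split; last exact: Phi1.
move=> j; rewrite -[1]/(1%:P) coefC; case: eqP => _; [exact: (loc1 hx)|exact: (loc0 hx)].
Qed.

(* As h > 0, no denominator can appear when solving (s + h) u = w. *)
Lemma graph_stalk_Xh h w : 0 < h -> pole_poly x f w ->
  graph_stalk (('X + (rc h)%:P) * w) -> graph_stalk w.
Proof.
move=> h0 /(Phi_surj hx f_neq0 xf 0) [q [_ <-]] [r [hr]].
rewrite mulrDl -Phi_s mul_polyC -Phi_scale -Phi_add => /(Phi_inj f_neq0) rE.
exists q; split=> //; elim=> [|j IH].
  have -> : q`_0 = rc h^-1 * r`_0.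
    rewrite rE coefD coefN coefXM /= oppr0 add0r coefZ mulrA -rmorphM.
    by rewrite mulVf ?gt_eqF // rmorph1 mul1r.
  by apply: (locM hx) => //; apply: (loc_rc hx).
have n0 : j.+1%:R + h != 0 by rewrite gt_eqF // ltr_wpDl.
have E : rc (j.+1%:R + h) * q`_j.+1 = r`_j.+1 + f * q`_j.
  rewrite rE coefD coefN coefXM /= coefB !coefZ coef_deriv -[q`_j.+1 *+ _]mulr_natr.
  by rewrite (rmorphD rc) (rmorph_nat rc); ring.
have -> : q`_j.+1 = rc (j.+1%:R + h)^-1 * (r`_j.+1 + f * q`_j).
  by rewrite -E mulrA -rmorphM mulVf // rmorph1 mul1r.
apply: (locM hx); first exact: (loc_rc hx).
by apply: (locD hx) => //; apply: (locM hx).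
Qed.

Lemma graph_stalk_pol s w : all (> 0) s -> pole_poly x f w ->
  graph_stalk (pol s * w) -> graph_stalk w.
Proof.
elim: s w => [|h s IH] w; first by rewrite pol_nil mul1r.
move=> /= /andP[h0 hs] pw; rewrite pol_cons.
rewrite [_ * pol s]mulrC -mulrA => H.
apply: (graph_stalk_Xh h0 pw); apply: IH => //.
by apply: (pole_polyM hx xf) => //; apply: (pole_poly_Xh hx xf).
Qed.

(** The coefficient of d_t^j f^s is (-1)^j s (s - 1) ... (s - j + 1) f^-j, here evaluated at s = -
    h. *)
Lemma horner_iter_dt1 j h : (iter j (dt f (rc 0)) 1).[- rc h]
  = rc (\prod_(i < j) (h + i%:R)) * f^-1 ^+ j.
Proof.
elim: j h => [|j IH] h; first by rewrite big_ord0 hornerC rmorph1 mulr1.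
rewrite /=; set W := iter j _ 1 in IH *.
have -> : dt f (rc 0) W = - ('X * tpow f (-1) W) by rewrite /dt rmorph0 subr0.
rewrite hornerN hornerM hornerX mulNr opprK /tpow hornerZ.
rewrite horner_comp hornerD hornerX hornerC exprN1 rmorphN1.
have -> : - rc h - 1 = - rc (h + 1) by rewrite rmorphD rmorph1 opprD.
rewrite IH big_ord_recl addr0 rmorphM exprS.
under [in RHS]eq_bigr do rewrite /= /bump /= natrD addrA.
ring.
Qed.

Lemma horner_sum_iter_dt c p (W : 'I_p.+1 -> {poly K}) :
  (\sum_(i < p.+1) iter i (dt f c) (W i)).[c] = (W ord0).[c].
Proof.
rewrite big_ord_recl hornerD horner_sum big1 ?addr0 // => i _ /=.
by rewrite /dt hornerN hornerM hornerXsubC subrr mul0r oppr0.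
Qed.

(** * Top coefficients in d_t *)

Section TopCoefficient.
Variable p : nat.

Definition lower_span : set {poly K} := sDs [set w | w = f%:P \/
  exists2 j, (j < p)%N & w = iter j (dt f (rc 0)) 1].

(* D[s] (f, d_t^j 1 | j < p) meets d_t^p K[s] only in d_t^p D[s] (f, J_f). *)
Lemma lower_spanP w : lower_span w -> exists y r,
  [/\ J y, loc_poly r, (size r <= p)%N & w = iter p (dt f (rc 0)) y + Phi f (rc 0) r].
Proof.
have DJ : Ds J by apply: sDs_Ds.
pose S := [set w | exists y r, [/\ J y, loc_poly r, (size r <= p)%N
  & w = iter p (dt f (rc 0)) y + Phi f (rc 0) r]].
(* A remainder reaching degree p in d_t is repaired by moving its top coefficient into y. It arises
   from s, with a multiple of f on top, from a derivation, with a multiple of xi(f), and from the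
   generator f when p = 0. *)
have absorb y r : J y -> loc_poly r -> (size r <= p.+1)%N -> J (r`_p)%:P ->
    S (iter p (dt f (rc 0)) y + Phi f (rc 0) r).
  move=> Jy hr sr Jp; exists (y + (r`_p)%:P), (\poly_(j < p) r`_j).
  split; [exact: (DsD DJ)| | exact: size_poly |].
    by move=> j; rewrite coef_poly; case: ifP => // _; apply: (loc0 hx).
  rewrite iter_dt_add -addrA; congr (_ + _).
  rewrite -[X in iter p _ X](PhiC f (rc 0)) -Phi_iter_dt -Phi_add.
  congr (Phi _ _ _); apply/polyP => j; rewrite coefD coef_poly mulrC coefCM coefXn.
  case: (ltngtP j p) => [jp|jp|->]; rewrite ?mulr0 ?mulr1 ?add0r ?addr0 //.
  by rewrite nth_default // (leq_trans sr).
suff DS : Ds S.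
  apply: (sDs_sub DS) => _ [->|[j jp ->]]; last first.
    exists 0, 'X^j; split; [exact: (Ds0 DJ)| |by rewrite size_polyXn|].
      move=> i; rewrite coefXn; exact: (loc_nat hx).
    by rewrite linear0 add0r -['X^j]mulr1 Phi_iter_dt Phi1.
  have := absorb 0 f%:P; rewrite linear0 add0r PhiC; apply.
  - exact: (Ds0 DJ).
  - by move=> j; rewrite coefC; case: eqP => // _; apply: (loc0 hx).
  - exact: leq_trans (size_polyC_leq1 _) _.
  rewrite coefC; case: eqP => _; last exact: (Ds0 DJ).
  by apply: sub_gen_smallest; left.
split.
- split=> [|_ _ [y [r [Jy hr sr ->]]] [y' [r' [Jy' hr' sr' ->]]]].
    exists 0, 0; split; [exact: (Ds0 DJ)| |by rewrite size_poly0|].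
      by move=> j; rewrite coef0; apply: (loc0 hx).
    by rewrite !linear0 addr0.
  exists (y + y'), (r + r'); split; [exact: (DsD DJ)| | |].
  + by move=> j; rewrite coefD; apply: (locD hx).
  + by rewrite (leq_trans (size_polyD _ _)) // geq_max sr.
  + by rewrite iter_dt_add Phi_add addrACA.
- move=> a _ xa [y [r [Jy hr sr ->]]].
  exists (a *: y), (a *: r); split; [exact: (DsZ DJ)| | |].
  + by move=> j; rewrite coefZ; apply: (locM hx).
  + exact: leq_trans (size_scale_leq _ _) sr.
  + by rewrite iter_dt_scale Phi_scale scalerDr.
- move=> _ [y [r [Jy hr sr ->]]].
  (* This is s d_t^p = d_t^p (s + p). *)
  have -> : 'X * (iter p (dt f (rc 0)) y + Phi f (rc 0) r)
     = iter p (dt f (rc 0)) (('X + (rc p%:R)%:P) * y)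
       + Phi f (rc 0) (- ('X * (f *: r - r^`()))).
    rewrite Phi_s mulrDr; congr (_ + _).
    rewrite mulrDl iter_dt_add iter_dtX mul_polyC iter_dt_scale -mul_polyC.
    by rewrite rmorph_nat; ring.
  apply: absorb; [exact: (DsXh hx DJ)|exact: loc_poly_s| |].
    rewrite size_polyN (leq_trans (size_polyMleq _ _)) // size_polyX /=.
    rewrite ltnS (leq_trans (size_polyD _ _)) // geq_max size_polyN.
    rewrite (leq_trans (size_scale_leq _ _)) //.
    by rewrite (leq_trans (size_poly _ _)) // (leq_trans (leq_pred _)).
  rewrite coefN coefXM; case: eqP => [_|/eqP p0].
    by rewrite oppr0; exact: (Ds0 DJ).
  rewrite coefB coefZ coef_deriv prednK ?lt0n // [r`_p]nth_default // mul0rn subr0.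
  rewrite mulrC -mulNr polyCM mul_polyC; apply: (DsZ DJ).
    exact: (locN hx).
  by apply: sub_gen_smallest; left.
- move=> xi _ hxi [y [r [Jy hr sr ->]]].
  rewrite -[_ + _]/(ders xi f _) (dersD hxi) -(Phi_der0 _ hxi).
  rewrite (ders_iter_dt hxi f_neq0); last by rewrite rmorph0 (der0 hxi).
  apply: absorb; [exact: (Ds_der DJ)|exact: loc_poly_der| |].
    rewrite (leq_trans (size_polyD _ _)) // geq_max size_polyN.
    rewrite (leq_trans (size_poly _ _)) ?(leq_trans sr) //=.
    rewrite (leq_trans (size_scale_leq _ _)) //.
    by rewrite (leq_trans (size_polyMleq _ _)) // size_polyX.
  rewrite coefB (coef_mapd hxi) nth_default // (der0 hxi) sub0r coefZ coefXM.
  case: eqP => _; first by rewrite mulr0 oppr0; apply: (Ds0 DJ).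
  rewrite mulrC -mulNr polyCM mul_polyC; apply: (DsZ DJ); first exact: (locN hx).
  by apply: sub_gen_smallest; right; exists xi.
Qed.

(** With P = [pol s], P(s) d_t^p = d_t^p P(s + p). By [lower_spanP], d_t^p sends P(s + p) - y to
    degree < p in s; as it raises degrees by p, this difference is zero. *)
Lemma pol_lower_span s : lower_span (pol s * iter p (dt f (rc 0)) 1) ->
  J (pol [seq h + p%:R | h <- s]).
Proof.
set s' := map _ _.
have -> : pol s * iter p (dt f (rc 0)) 1 = iter p (dt f (rc 0)) (pol s').
  rewrite -[pol s']mulr1 iter_dt_pol -map_comp (eq_map (g := id)) ?map_id //.
  by move=> h /=; rewrite addrK.
move=> /lower_spanP [y [r [Jy _ sr E]]].
suff -> : pol s' = y by [].
apply/eqP; rewrite -subr_eq0; apply/negP => /negP ne.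
have := size_iter_dt f_neq0 (rc 0) p ne.
have -> : iter p (dt f (rc 0)) (pol s' - y) = Phi f (rc 0) r.
  by rewrite linearB /= E addrAC subrr add0r.
rewrite size_Phi // => e; move: sr; rewrite e.
by rewrite -[X in (_ <= X)%N]add0n leq_add2r leqn0 size_poly_eq0 (negPf ne).
Qed.

End TopCoefficient.

Lemma roots_of_F_M (alpha : rat) (halpha : 0 < alpha <= 1) l (hl : (1 < l)%N) p :
    F_M iota x f l (1 - alpha) p (1 / f ^+ p.+1) ->
  exists2 s, all (>= (ratr alpha + p%:R)) s & Lat 1 (pol (1 :: s)).
Proof.
set al : R := ratr alpha.
have al0 : 0 < al by rewrite ltr0q; case/andP: halpha.
pose i1 : 'I_l := Ordinal hl.
have tw : twist (1 - alpha) i1 = 1 - al :> R.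
  by rewrite /twist mul1r rmorphB rmorph1.
move=> [v [hv vE]].
have [[V hV Vv] [gv sv]] := hv ord0.
set w := PhiE iota f (1 - alpha) (v ord0) i1.
have sw : (size w <= p.+1)%N by rewrite size_Phi //; have := sv i1; rewrite subn0.
have pw : pole_poly x f w := graph_PhiE hx f_neq0 xf (1 - alpha) gv i1.
have wE : w.[rc (1 - al)] = f^-1 ^+ p.+1.
  have : PhiE iota f (1 - alpha) (y_delta l (1 / f ^+ p.+1)) i1
     = \sum_(i < p.+1) iter i (dt f (rc (1 - al))) (PhiE iota f (1 - alpha) (v i) i1).
    by rewrite vE PhiE_sum; apply: eq_bigr => i _; rewrite PhiE_iter_dt tw.
  rewrite /PhiE ffunE eqxx PhiC => /(congr1 (horner^~ (rc (1 - al)))).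
  by rewrite hornerC horner_sum_iter_dt exprVn mul1r => <-.
set u := tpow f 1 w.
(* [V_push] is run until [V_Lat] applies and gives L; the sign (-1)^n is undone by applying it
   again. Multiplication by t then turns L into t L and each index h - (1 - alpha) into h + alpha >=
   alpha. *)
have [s hs Lu] : exists2 s, all (>= al) s & Lat 1 (pol s * u).
  have [g Hg] := V_Lat hV i1.
  have [s [u' [n [hs Vu Eu]]]] := V_push hV i1 Vv g.
  have DL := Lat_Ds hx f_neq0 0 (iota := iota).
  have {}Lu : Lat 0 (pol [seq h - twist (1 - alpha) i1 | h <- s] * w).
    have := DsZ DL (locX hx n (locN hx (loc1 hx))) (Hg _ Vu).
    by rewrite Eu scalerA -exprD addnn -mul2n exprM sqrrN !expr1n scale1r.
  exists [seq h + 1 | h <- [seq h - twist (1 - alpha) i1 | h <- s]].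
    apply/allP => _ /mapP[_ /mapP[h /(allP hs) /= h0 ->] ->] /=.
    by rewrite tw; lra.
  have /(Lat_tpow iota x f_neq0 0 1) := Lu.
  by rewrite add0r tpow_pol mulr1z.
have pu : pole_poly x f u by exact: (pole_poly_tpow hx f_neq0 xf 1 pw).
(* All indices are positive since alpha > 0, so u has no denominators in the d_t-encoding. *)
have [q [hq qE]] : graph_stalk u.
  apply: (@graph_stalk_pol s) => //.
    by apply: sub_all hs => h /=; apply: lt_le_trans.
  by apply: Lat0_graph_stalk; apply: (Lat_le hx f_neq0 xf) Lu.
have sq : (size q <= p.+1)%N by rewrite -(size_Phi f_neq0 (rc 0)) qE size_tpow.
have uE : u.[- rc al] = f^-1 ^+ p.
  rewrite /u /tpow hornerZ horner_comp hornerD hornerX hornerC.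
  have -> : - rc al + 1%:~R = rc (1 - al) by rewrite mulr1z (rmorphB rc) rmorph1 addrC.
  by rewrite wE exprS mulrA expr1z mulfV ?mul1r.
move: (qE); rewrite (Phi_widen f (rc 0) sq) big_ord_recr /=.
set D := fun j => iter j (dt f (rc 0)) 1.
set e := fun j => rc (\prod_(i < j) (al + i%:R)).
move=> qE'.
have xe j : x (e j) := loc_rc hx _.
(* Evaluate u at s = - alpha and multiply by f^p: each term with j < p keeps a factor f, the term j
   = p gives q_p e_p, and the total is 1. *)
have [b xb one] : exists2 b, x b & 1 = q`_p * e p + f * b.
  exists (\sum_(j < p) q`_j * e j * f ^+ (p - j.+1)).
    apply: (loc_sum hx) => j; apply: (locM hx); last exact: (locX hx).
    exact: (locM hx).
  have : f ^+ p * u.[- rc al] = 1 by rewrite uE exprVn mulfV ?expf_neq0.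
  rewrite -qE' hornerD horner_sum hornerZ horner_iter_dt1 -/(e p) => <-.
  rewrite mulrDr addrC mulr_sumr mulr_sumr; congr (_ + _).
    by rewrite exprVn; field; rewrite expf_neq0.
  apply: eq_bigr => j _; rewrite hornerZ horner_iter_dt1 -/(e j) exprVn.
  have -> : f ^+ p = f * f ^+ (p - j.+1) * f ^+ j.
    by rewrite -exprS -exprD; congr (_ ^+ _); have := ltn_ord j; lia.
  by field; rewrite expf_neq0.
exists [seq h + p%:R | h <- s].
  by apply/allP => _ /mapP[h /(allP hs) /= hh ->]; rewrite lerD2r.
rewrite pol_cons rmorph1; apply/(Lat1_reduced hx f_neq0).
apply: pol_lower_span.
have DT : Ds (lower_span p) by apply: sDs_Ds.
have Tf : lower_span p f%:P by apply: sub_gen_smallest; left.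
have TD j : (j < p)%N -> lower_span p (D j).
  by move=> jp; apply: sub_gen_smallest; right; exists j.
have TfD : lower_span p (f *: D p).
  case: (p) DT Tf TD => [|p'] DT Tf TD.
    by rewrite /D /= -mul_polyC mulr1.
  rewrite /D scale_iter_dt1 //; apply: (DsN hx DT).
  have := DsXh hx DT (- p'%:R) (TD p' (leqnn _)).
  by rewrite rmorphN rmorph_nat polyCN.
(* The relation 1 = q_p e_p + f b applied to d_t^p f^s. Of the three terms, the last two already lie
   in [lower_span p], and [pol s] carries the first into t L, contained in it. *)
have -> : iter p (dt f (rc 0)) 1 = e p *: u
    - e p *: (\sum_(j < p) q`_j *: D j) + b *: (f *: D p).
  rewrite -scalerBr -qE' [X in X - _]addrC addrK !scalerA -scalerDl.
  by rewrite [e p * _]mulrC [b * f]mulrC -one scale1r.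
have T1 : lower_span p (tpow f 1 1) by rewrite (tpowC f 1 1) mulr1.
have Tu : lower_span p (pol s * u) := Lat_sub hx f_neq0 DT T1 Lu.
rewrite mulrDr mulrBr -[pol s * (e p *: u)]scalerAr.
rewrite -[pol s * (e p *: \sum_(j < p) _)]scalerAr -[pol s * (b *: _)]scalerAr.
apply: (DsD DT); last by apply: (DsZ DT) => //; apply: (Ds_pol hx DT).
apply: (DsB hx DT); apply: (DsZ DT) => //.
apply: (Ds_pol hx DT); apply: (Ds_sum DT) => j; apply: (DsZ DT) => //.
exact: TD.
Qed.

End Necessity.

(** * Globalization *)

Section Points.
Context {R : realType} {K : fieldType} (iota : {rmorphism R[i] -> K}).
Implicit Types (A m I x : set K).

Lemma maximal_ideal_prime A m b c : subalgebra iota A -> maximal_ideal A m ->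
  A b -> A c -> ~ m b -> ~ m c -> ~ m (b * c).
Proof.
move=> hA [[mA m0 mD mM] m1 mmax] Ab Ac nb nc mbc; have [_ AB AM] := hA.
pose I := [set a | exists u r, [/\ m u, A r & a = u + r * b]].
have II : is_ideal A I.
  split.
  - by move=> _ [u [r [mu Ar ->]]]; apply: (locD hA); [apply: mA|apply: AM].
  - exists 0, 0; split; [exact: m0|exact: loc0 hA|].
    by rewrite mul0r addr0.
  - move=> _ _ [u [r [mu Ar ->]]] [u' [r' [mu' Ar' ->]]].
    exists (u + u'), (r + r'); split; [exact: mD|exact: (locD hA)|].
    by rewrite mulrDl addrACA.
  - move=> a _ Aa [u [r [mu Ar ->]]].
    exists (a * u), (a * r); split; [exact: mM|exact: AM|].
    by rewrite mulrDr mulrA.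
have mI : m `<=` I.
  by move=> u mu; exists u, 0; split=> //; [exact: loc0 hA|rewrite mul0r addr0].
have Ib : I b.
  by exists 0, 1; split=> //; [exact: loc1 hA|rewrite mul1r add0r].
have [[u [r [mu Ar e]]]|nI1] := pselect (I 1).
  apply: nc; rewrite -[c]mul1r e mulrDl -mulrA; apply: mD; last exact: mM.
  by rewrite mulrC; apply: mM.
by apply: nb; rewrite -(mmax I).
Qed.

Lemma localization_subalgebra A m : subalgebra iota A -> maximal_ideal A m ->
  subalgebra iota (localization A m).
Proof.
move=> hA hm; have [AC AB AM] := hA; have [[_ m0 _ _] m1 _] := hm.
have A1 := loc1 hA.
have ne0 c : ~ m c -> c != 0 by move=> nc; apply/eqP => c0; apply: nc; rewrite c0.
split=> [c|_ _ [b [c [Ab Ac nc ->]]] [b' [c' [Ab' Ac' nc' ->]]]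
  |_ _ [b [c [Ab Ac nc ->]]] [b' [c' [Ab' Ac' nc' ->]]]].
- by exists (iota c), 1; split=> //; rewrite divr1.
- exists (b * c' - b' * c), (c * c'); split.
  + by apply: AB; apply: AM.
  + exact: AM.
  + exact: (maximal_ideal_prime hA hm).
  + by field; rewrite !ne0.
- exists (b * b'), (c * c'); split; [exact: AM|exact: AM| |].
  + exact: (maximal_ideal_prime hA hm).
  + by field; rewrite !ne0.
Qed.

Lemma point_subalgebra X x : is_variety iota X -> X x -> subalgebra iota x.
Proof.
move=> [[n [A [hA _ _ ->]]] _ _] [i _ [m [hm ->]]].
exact: localization_subalgebra.
Qed.

End Points.

(** * Divisibility and real roots of Bernstein-Sato polynomials *)

Section BernsteinSato.
Context {R : realType} {K : fieldType} (iota : {rmorphism R[i] -> K}).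
Local Notation pol := (pol iota).

Lemma Lat1E (x : set K) f : subalgebra iota x -> f != 0 -> forall w,
  smallest (Ds_submodule iota x f) [set f%:P] w <-> Lat iota x f 1 w.
Proof.
move=> hx f0 w; split.
  apply: sDs_sub; first exact: (Lat_Ds hx f0).
  by move=> _ ->; apply: Lat1f.
apply: (Lat_sub hx f0); first exact: sDs_Ds.
by rewrite (tpowC f 1 1) mulr1; apply: sub_gen_smallest.
Qed.

Lemma Ds_mul_const (x : set K) f N (q : {poly R[i]}) u : subalgebra iota x ->
  Ds_submodule iota x f N -> N u -> N (map_poly iota q * u).
Proof.
move=> hx DN Nu; elim/poly_ind: q => [|q c IH].
  by rewrite map_poly0 mul0r; apply: (Ds0 DN).
rewrite rmorphD rmorphM /= map_polyX map_polyC mulrDl mulrAC mulrC.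
apply: (DsD DN); first exact: (DsX DN).
by rewrite mul_polyC; apply: (DsZ DN) => //; apply: loc_const hx _.
Qed.

(** Euclidean division: the remainder satisfies the same equation in smaller degree, so minimality
    forces it to vanish. *)
Lemma bernstein_sato_dvd U f (b q : {poly R[i]}) :
    (forall x, U x -> subalgebra iota x) ->
  is_bernstein_sato iota U f b -> bs_equation iota U f q -> b %| q.
Proof.
move=> hU [bmon beq bmin] qeq; rewrite /dvdp; apply/eqP.
apply: contrapT => /eqP r0.
have : bs_equation iota U f (q %% b).
  move=> x Ux; have hx := hU x Ux.
  have DN : Ds_submodule iota x f (smallest (Ds_submodule iota x f) [set f%:P]).
    exact: sDs_Ds.
  have -> : q %% b = q - q %/ b * b by rewrite {2}(divp_eq q b) addrC addKr.
  rewrite rmorphB rmorphM; apply: (DsB hx DN); first exact: qeq.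
  by apply: (Ds_mul_const _ hx DN); apply: beq.
by move/(bmin _ r0); rewrite leqNgt ltn_modp monic_neq0.
Qed.

Lemma real_roots_pol (b : {poly R[i]}) (P : R -> Prop) : b \is monic ->
    (forall z, root b z -> exists2 c, z = ((- c)%:C)%C & P c) ->
  exists2 s, map_poly iota b = pol s & forall c, c \in s -> P c.
Proof.
move=> bmon hroot; have [rs bE] := closed_field_poly_normal b.
rewrite (monicP bmon) scale1r in bE.
have hrs z : z \in rs -> exists2 c, z = ((- c)%:C)%C & P c.
  by move=> zr; apply: hroot; rewrite bE root_prod_XsubC.
rewrite bE {bE hroot bmon b}; elim: rs hrs => [|z rs IH] hrs.
  by exists [::] => //; rewrite big_nil pol_nil rmorph1.
have [s sE sP] := IH (fun z h => hrs z (mem_behead (s := _ :: _) h)).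
have [c zE Pc] := hrs z (mem_head _ _).
exists (c :: s); last by move=> a; rewrite inE => /orP[/eqP ->|/sP].
rewrite big_cons pol_cons rmorphM /= sE rmorphB /= map_polyX map_polyC /= zE.
by rewrite -polyCN -rmorphN -rmorphN opprK.
Qed.

End BernsteinSato.

Theorem corollaryC (R : realType) (K : fieldType)
  (iota : {rmorphism R[i] -> K})
  (X : set (set K)) (hX : is_smooth_variety iota X)
  (Z : divisor K) (hZ : effective_divisor X Z)
  (hZ0 : nonzero_divisor Z) (hZr : reduced_divisor Z)
  (alphaZ : \bar R) (halphaZ : is_minimal_exponent iota Z alphaZ)
  (alpha : rat) (halpha : 0 < alpha <= 1)
  (l : nat) (hl : (2 <= l)%N) (hlb : l%:R * (1 - alpha) \is a Num.int)
  (p : nat) :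
  (forall x, X x -> hodge_ideal iota Z alpha l p x = x) <->
  ((p%:R)%:E <= alphaZ - (ratr alpha)%:E)%E.
Proof.
have [hvar _] := hX; have [hopen hcover hne0 hreg _] := hZ.
have hsub i x (Ux : @div_open K Z i x) : X x by case: (hopen i) => + _; apply.
have hU i x (Ux : @div_open K Z i x) : subalgebra iota x.
  exact: point_subalgebra hvar (hsub _ _ Ux).
have [b [[bmon [bs [hbs blcm]]] hb']] := halphaZ.
have bsmin i : is_bernstein_sato iota (@div_open K Z i) (@div_eqn K Z i) (bs i).
  exact: hbs.
have Lb i x : @div_open K Z i x ->
    Lat iota x (@div_eqn K Z i) 1 (map_poly iota b).
  move=> Ux; have hx := hU i x Ux; apply/(Lat1E hx (hne0 i)).
  have /dvdpP [q ->] := (blcm b).1 (dvdpp b) i.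
  have [_ beq _] := bsmin i; rewrite rmorphM.
  apply: (Ds_mul_const q hx _ (beq x Ux)); exact: sDs_Ds.
(* At a point of Z, setting s = -1 gives b(-1) = c f with c regular; a nonzero value would make f a
   unit there. *)
have rootb : root b (- 1).
  have [i [x [Ux nx]]] := hZ0; have hx := hU i x Ux.
  have [c xc] := Lat1_horner hx (hne0 i) (Lb i x Ux).
  rewrite -(rmorphN1 iota) horner_map => e.
  apply: contrapT => /negP nr; apply: nx.
  have -> : (@div_eqn K Z i)^-1 = c * iota (b.[- 1]^-1).
    have : iota b.[- 1] != 0 by rewrite fmorph_eq0.
    rewrite fmorphV => ne; apply: (mulIf ne); rewrite divfK //.
    by rewrite e mulrCA mulVf ?hne0 // mulr1.
  by apply: (locM hx) => //; apply: (loc_const hx).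
have [b1 bE] : exists b1, b = b1 * ('X + 1).
  by have /factor_theorem [b1 ->] := rootb; exists b1; rewrite polyCN opprK.
have X1mon : ('X + 1 : {poly R[i]}) \is monic.
  by have := monicXsubC (- 1 : R[i]); rewrite polyCN opprK.
have b1E : b %/ ('X + 1) = b1 by rewrite bE mulpK ?monic_neq0.
have b1mon : b1 \is monic by move: bmon; rewrite bE monicMr.
rewrite /= b1E in hb'.
have trivial_ideal (cs : seq R) : map_poly iota b1 = pol iota cs ->
    all (>= (ratr alpha + p%:R)) cs ->
    forall x, X x -> hodge_ideal iota Z alpha l p x = x.
  move=> csE cs_ge x Xx; apply/seteqP; split=> [g []//|g xg].
  split=> // i Ux; have hx := hU i x Ux.
  apply: (F_M_of_roots hx (hne0 i) (hreg i x Ux) (cs := cs)) => //.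
  have := Lb i x Ux; rewrite bE rmorphM /= csE pol_cons mulrC.
  by rewrite rmorphD /= map_polyX !rmorph1.
case: alphaZ halphaZ hb' => [r| |] _ //=.
- move=> [rootr maxr]; rewrite -EFinB lee_fin; split; last first.
    move=> pr; have [z /maxr|cs csE cs_ge] := real_roots_pol iota (P := >= r) b1mon.
      rewrite lecE => /andP[/eqP /= im re]; exists (- complex.Re z).
        by rewrite opprK; case: z im {re} => u v /= <-.
      by rewrite lerNr.
    apply: (trivial_ideal cs) => //; apply/allP => c /cs_ge /=; lra.
  (* If r < alpha + p, the factor s + r can be removed from b: the quotient q still satisfies every
     local equation, so b divides q, against the degrees. *)
  move=> H; rewrite leNgt; apply/negP => lt_r.
  have /factor_theorem [b2 b2E] := rootr.
  (* Keeping s + 1 in q is what covers the case r = 1. *)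
  pose q := ('X + 1) * b2.
  have /dvdp_leq : b %| q.
    apply/blcm => i; apply: (bernstein_sato_dvd (hU i) (bsmin i)) => x Ux.
    have hx := hU i x Ux; apply/(Lat1E hx (hne0 i)).
    have DL := Lat_Ds hx (hne0 i) 1 (iota := iota).
    have [s hs Ls] : exists2 s, all (>= (ratr alpha + p%:R)) s &
        Lat iota x (@div_eqn K Z i) 1 (pol iota (1 :: s)).
      apply: (roots_of_F_M hx (hne0 i) (hreg i x Ux) halpha hl).
      have : hodge_ideal iota Z alpha l p x 1.
        by rewrite H; [exact: (loc1 hx)|exact: hsub Ux].
      by case=> _; apply.
    have rns : r \notin s.
      by apply/negP => /(allP hs) /=; lra.
    have mapX1 : map_poly iota ('X + 1) = 'X + (rc iota 1)%:P.
      by rewrite rmorphD /= map_polyX !rmorph1.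
    (* Both (s + r) q = b and [pol s] q = [pol (1 :: s)] b2 carry f^s into t L, and their factors s
       + r and [pol s] are coprime. *)
    apply: (Ds_coprime1 hx DL rns).
      have mapXr : map_poly iota ('X - ((- r)%:C%C)%:P) = 'X + (rc iota r)%:P.
        by rewrite rmorphB /= map_polyX map_polyC /= !rmorphN /= opprK.
      have := Lb i x Ux.
      have -> : b = ('X - ((- r)%:C%C)%:P) * q by rewrite bE b2E /q; ring.
      by rewrite rmorphM /= mapXr.
    have := Ds_mul_const b2 hx DL Ls; rewrite pol_cons /q rmorphM /= mapX1.
    by congr (Lat _ _ _ _ _); ring.
  have b2n : b2 != 0.
    by apply: contraTneq b1mon => b20; rewrite b2E b20 mul0r monicE lead_coef0 eq_sym oner_eq0.
  have q0 : q != 0 by rewrite mulf_neq0 // monic_neq0.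
  have -> : b = q * ('X - ((- r)%:C%C)%:P) by rewrite bE b2E /q; ring.
  by move=> /(_ q0); rewrite size_Mmonic ?monicXsubC // size_XsubC addn2 ltnn.
- move=> sz; split=> // _; first by rewrite addye // leey.
  (* The reduced polynomial is monic and constant, hence 1, the product over the empty list. *)
  apply: (trivial_ideal [::]) => //; rewrite pol_nil.
  rewrite (size1_polyC sz); move: b1mon; rewrite (size1_polyC sz).
  by rewrite monicE lead_coefC coefC eqxx => /eqP ->; rewrite rmorph1.
Qed.
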